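(* Let $\Omega$, $\mathbb{K}$, $g$ be as in the context, and let $\mathcal{A}_\sigma$ be a $\sigma$-algebra on $\mathbb{K}$ such that $z\mapsto\int_0^\infty\varrho(t)g(z(t))dt$ is $\mathcal{A}_\sigma$-measurable for every $\varrho\in\mathfrak{D}$. For each $\omega\in\Omega$ let $\mathcal{L}(\omega),\mathcal{M}(\omega)$ be nonempty sets, and for each $(l,m)\in\mathcal{L}(\omega)\times\mathcal{M}(\omega)$ let $\mathbb{M}^\omega_{lm}$ denote the expectation with respect to a given probability measure on $(\mathbb{K},\mathcal{A}_\sigma)$. For $\varrho\in\mathfrak{D}$ define $\mathcal{V}[\varrho](\omega)=\sup_{l\in\mathcal{L}(\omega)}\inf_{m\in\mathcal{M}(\omega)}\mathbb{M}^\omega_{lm}\int_0^\infty\varrho(t)g(z(t))dt$. Assume that for all $\varrho\in\mathfrak{D}$ and $T>0$ the maps $z\mapsto\int_0^\infty\varrho(t)g(z(t))dt$ and $z\mapsto\mathcal{V}[\varrho](z(T))$ are $\mathcal{A}_\sigma$-measurable, and that either the identity $$\mathcal{V}[\varrho](\omega)=\sup_{l\in\mathcal{L}(\omega)}\inf_{m\in\mathcal{M}(\omega)}\mathbb{M}^\omega_{lm}\Big[\int_0^T\varrho(t)g(z(t))dt+\sup_{l'\in\mathcal{L}(z(T))}\inf_{m'\in\mathcal{M}(z(T))}\mathbb{M}^{z(T)}_{l'm'}\int_0^\infty\varrho(t+T)g(z_1(t))dt\Big]$$ (outer expectation over $z$, inner over $z_1$) holds for all $\varrho\in\mathfrak{D}$,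 $\omega\in\Omega$ and all real $T>0$, or $z(n+s)=z(n)$ holds for all $z\in\mathbb{K}$, $n\in\mathbb{N}\cup\{0\}$, $s\in(0,1)$ and the identity holds for all $\varrho\in\mathfrak{D}$, $\omega\in\Omega$ and all $T\in\mathbb{N}$. Then for every $U_*:\Omega\to[0,1]$ the following are equivalent: (c) for every density $\mu\in\mathfrak{D}$ piecewise continuous on $(0,\infty)$, $\lim_{\lambda\to+0}\sup_{\omega}|\mathcal{V}[\mu^\lambda_{\mathrm{scale}}](\omega)-U_*(\omega)|=0$; (u) $\lim_{T\to+\infty}\sup_\omega|\mathcal{V}[\varpi_T](\omega)-U_*(\omega)|=0$; (e) $\lim_{\lambda\to+0}\sup_\omega|\mathcal{V}[\pi_\lambda](\omega)-U_*(\omega)|=0$; (p) for some power density $\varrho\in\mathfrak{D}$, $\lim_{T\to+\infty}\sup_\omega|\mathcal{V}[\varrho^T_{\mathrm{shift}}](\omega)-U_*(\omega)|=0$; (q) this holds for every power density $\varrho\in\mathfrak{D}$.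
   Context: $\mathbb{R}_+=[0,\infty)$. $\Omega$ is a nonempty set, $\mathbb{K}$ a nonempty set of maps $\mathbb{R}_+\to\Omega$, $g:\Omega\to[0,1]$ with $t\mapsto g(z(t))$ Lebesgue measurable for each $z\in\mathbb{K}$. $\mathfrak{D}$: probability densities $\varrho:\mathbb{R}_+\to\mathbb{R}_+$. For $T>0$ with $\int_T^\infty\varrho>0$: $\varrho^T_{\mathrm{shift}}(t)=\varrho(t+T)/\int_T^\infty\varrho$; for $\lambda>0$: $\varrho^\lambda_{\mathrm{scale}}(t)=\lambda\varrho(\lambda t)$. $\varpi_T(t)=\frac1T1_{[0,T]}(t)$, $\pi_\lambda(t)=\lambda e^{-\lambda t}$. A power density is $\varrho\in\mathfrak{D}$ with $\varrho(t)=(\alpha+\beta t)^{-\gamma}$ for some $\alpha,\beta,\gamma>0$. *)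

(* Defs.v *)
From mathcomp Require Import all_boot all_order all_algebra all_classical all_reals all_analysis.
From mathcomp Require Import measurable_realfun.
Import Order.TTheory GRing.Theory Num.Theory numFieldNormedType.Exports.
Set Implicit Arguments. Unset Strict Implicit. Unset Printing Implicit Defensive.
Local Open Scope ring_scope. Local Open Scope classical_set_scope.
Local Open Scope ereal_scope.

Section Defs.
Context {R : realType}.

(* The real line with the Lebesgue (= completed, Caratheodory) sigma-algebra;
   its carrier is R. *)
Definition LR : measurableType _ :=
  ltac:(let t := type of (@completed_lebesgue_measure R) in
        match t with set ?T -> _ => exact T end).

Definition leb_int (A : set R) (f : R -> R) : \bar R :=
  \int[@completed_lebesgue_measure R]_(t in A) (f t)%:E.

Definition leb_measurable (D : set R) (f : R -> R) : Prop :=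
  measurable_fun (D : set LR) f.

(* frak D : probability densities on R_+ (values at t < 0 are irrelevant). *)
Definition is_density (rho : R -> R) : Prop :=
  [/\ leb_measurable `[0%R, +oo[ rho,
      (forall t, (0 <= t)%R -> (0 <= rho t)%R) &
      leb_int `[0%R, +oo[ rho = 1].

Definition scale_density (rho : R -> R) (lam : R) : R -> R :=
  fun t => (lam * rho (lam * t))%R.

Definition shift_density (rho : R -> R) (T : R) : R -> R :=
  fun t => (rho (t + T) / fine (leb_int `[T, +oo[ rho))%R.

Definition unif_density (T : R) : R -> R :=
  fun t => (T^-1 * \1_(`[0%R, T]) t)%R.

Definition exp_density (lam : R) : R -> R :=
  fun t => (lam * expR (- (lam * t)))%R.

Definition is_power_density (rho : R -> R) : Prop :=
  is_density rho /\
  exists alpha beta gamma : R,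
    [/\ (0 < alpha)%R, (0 < beta)%R, (0 < gamma)%R &
        forall t, (0 <= t)%R -> rho t = ((alpha + beta * t) `^ (- gamma))%R].

Definition piecewise_continuous_pos (mu : R -> R) : Prop :=
  forall a b : R, (0 < a)%R -> (a < b)%R ->
    exists s : seq R,
      (forall x, (a <= x <= b)%R -> x \notin s -> {for x, continuous mu}) /\
      (forall x, x \in s -> cvg (mu t @[t --> x^'-]) /\ cvg (mu t @[t --> x^'+])).

Context {Omega : Type} {d : measure_display} {K : measurableType d}.
Context (ev : K -> R -> Omega) (g : Omega -> R).
Context (L M : Omega -> Type)
        (P : forall w : Omega, L w -> M w -> probability K R).

Definition payoff (rho : R -> R) (z : K) : \bar R :=
  leb_int `[0%R, +oo[ (fun t => rho t * g (ev z t))%R.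

Definition value (rho : R -> R) (w : Omega) : \bar R :=
  ereal_sup (range (fun l : L w =>
    ereal_inf (range (fun m : M w => \int[P l m]_(z in setT) payoff rho z)))).

Definition dp_identity (rho : R -> R) (w : Omega) (T : R) : Prop :=
  value rho w =
  ereal_sup (range (fun l : L w =>
    ereal_inf (range (fun m : M w =>
      \int[P l m]_(z in setT)
         (leb_int `[0%R, T] (fun t => rho t * g (ev z t))%R
          + value (fun t => rho (t + T)%R) (ev z T)))))).

Definition sup_dist (rho : R -> R) (U : Omega -> R) : \bar R :=
  ereal_sup (range (fun w => `| value rho w - (U w)%:E |)).

End Defs.

(* Main.v *)
Require Import Defs.
From mathcomp Require Import all_boot all_order all_algebra all_classical all_reals all_analysis.
From mathcomp Require Import measurable_realfun.
From mathcomp Require Import ring lra.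
Import Order.TTheory GRing.Theory Num.Theory numFieldNormedType.Exports.
Set Implicit Arguments. Unset Strict Implicit. Unset Printing Implicit Defensive.
Local Open Scope ring_scope. Local Open Scope classical_set_scope.
Local Open Scope ereal_scope.

(* The uniform, exponential and (shifted) power densities are the rescalings
   mu_l(t) = l mu(l t) of a fixed mu that is nearly a constant a > 0 at 0 and whose
   tails are multiples of rescalings of mu.  If V[mu_l] -> U uniformly, the dynamic
   programming identity at time n for mu_{s/n} gives, with h = a s, the one-step
   relation: U(w) equals, up to O(h^2) + o(1) as n -> oo, the value at w of
   h times the mean of g over [0, n] plus (1 - h) U(z(n)).
   Dynamic programming cell by cell then shows that a step density with N cells of
   length n, each of mass at most eta, has value U up to
   theta + O(eta / theta) + N o(1), for every theta > 0.  Finally a piecewise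
   continuous density nu is approximated in L^1, uniformly for all small cell
   lengths, by step functions; taking the cell length to be an integer multiple of
   l and rescaling gives V[nu_l] -> U. *)

(** The stage function of the one-step relation contains [U (ev z n)] for an arbitrary [U].
    Expectations are therefore handled as suprema over simple functions, through three properties
    valid for all nonnegative functions: monotonicity, homogeneity and adding a constant. They make
    the sup-inf operator nonexpansive and homogeneous, which is what the error estimates require.
    The term O(h^2) is O(s^2): on [0, s] the density [mu] equals [a] up to O(s), so its mass there
    is [a * s] up to O(s^2). In the iteration, a cell of mass x that opens a remaining mass S has h
    = x / S and costs S h^2 = x^2 / S. This deteriorates as S tends to 0, so the iteration stops
    once S <= theta, where the value and S U both lie in [0, S]; before that the costs sum to O(eta
    / theta), since x <= eta. Dynamic programming is applied at integer times, which belong to both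
    alternatives of the hypothesis; hence the cell length must be an integer after rescaling. The
    number N of cells has to be bounded independently of l before the error o(1) is chosen against
    it. *)

Section affine_change_of_variables.
Context {R : realType}.
Local Notation leb := (@completed_lebesgue_measure R).
Implicit Types (a b c : R) (A X : set R).

(** * Increasing affine maps and the completed Lebesgue measure *)

Definition affine a b : R -> R := fun t => (a * t + b)%R.

Lemma wlength_affine a b (X : set R) : (0 < a)%R -> ocitv X ->
  ocitv (affine a b @` X) /\
  wlength idfun (affine a b @` X) = a%:E * wlength idfun X.
Proof.
move=> a0 [[x y] _ <-] /=.
have -> : affine a b @` (`]x, y]%classic : set R) = `](affine a b x), (affine a b y)]%classic.
  apply/seteqP; split=> [_ [t /= + <-]|t /=].
    by rewrite !in_itv/= /affine ltrD2r lerD2r ltr_pM2l// ler_pM2l.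
  rewrite !in_itv/= => /andP[xt ty]; exists ((t - b) / a)%R.
    rewrite /= in_itv/= ltr_pdivlMr// ler_pdivrMr//.
    by move: xt ty; rewrite /affine; lra.
  by rewrite /affine; field; rewrite gt_eqF.
split; first by exists (affine a b x, affine a b y).
rewrite !wlength_itv/= !lte_fin /affine ltrD2r ltr_pM2l//.
by case: ifPn => // _; rewrite ?mule0// -!EFinD -EFinM; congr EFin; ring.
Qed.

(** A cover of [X] by half-open intervals is mapped to a cover of the image, with all lengths
    multiplied by [a]. Here [leb] is the outer measure, so the bound covers the arbitrary test sets
    of the Caratheodory criterion. *)
Lemma leb_image_affine_le a b X : (0 < a)%R ->
  leb (affine a b @` X) <= a%:E * leb X.
Proof.
move=> a0.
rewrite -lee_pdivrMl//; apply: le_ereal_inf_tmp => _ [F [mF XF]] <-.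
rewrite lee_pdivrMl// -nneseriesZl//.
apply: ereal_inf_lbound; exists (fun k => affine a b @` F k).
  split=> [k|]; first by have [] := wlength_affine b a0 (mF k).
  move=> _ [x Xx <-]; have [k _ Fkx] := XF _ Xx.
  by exists k => //; exists x.
by apply: eq_eseriesr => k _; have [] := wlength_affine b a0 (mF k).
Qed.

Lemma affineK a b : a != 0%R ->
  cancel (affine a b) (affine a^-1 (- (a^-1 * b))).
Proof. by move=> a0 t; rewrite /affine; field. Qed.

Lemma affineKV a b : a != 0%R ->
  cancel (affine a^-1 (- (a^-1 * b))) (affine a b).
Proof. by move=> a0 t; rewrite /affine; field. Qed.

(** The inverse map is again increasing and affine, and the inequality for it is the converse
    one. *)
Lemma leb_image_affine a b X : (0 < a)%R ->
  leb (affine a b @` X) = a%:E * leb X.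
Proof.
move=> a0; apply/eqP; rewrite eq_le leb_image_affine_le//=.
have ai0 : (0 < a^-1)%R by rewrite invr_gt0.
have := @leb_image_affine_le a^-1 (- (a^-1 * b)) (affine a b @` X) ai0.
rewrite image_comp (_ : _ \o _ = id) ?image_id; last first.
  by apply/funext => t /=; rewrite affineK// gt_eqF.
by rewrite lee_pdivlMl.
Qed.

Lemma preimage_affine a b X : (0 < a)%R ->
  affine a b @^-1` X = affine a^-1 (- (a^-1 * b)) @` X.
Proof.
move=> a0; apply/seteqP; split=> [t Xt|_ [x Xx <-]] /=.
  by exists (affine a b t) => //; rewrite affineK// gt_eqF.
by rewrite affineKV// gt_eqF.
Qed.

Lemma leb_preimage_affine a b X : (0 < a)%R ->
  leb (affine a b @^-1` X) = a^-1%:E * leb X.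
Proof. by move=> a0; rewrite preimage_affine// leb_image_affine ?invr_gt0. Qed.

Lemma leb_measurableP A : measurable (A : set (@LR R)) <->
  forall X, leb X = leb (X `&` A) + leb (X `&` ~` A).
Proof. by split. Qed.

(** Continuity only controls preimages of Borel sets. For the Caratheodory sigma-algebra each test
    set is written as the preimage of its image, and the criterion for [A] is multiplied by
    [a^-1]. *)
Lemma measurable_affine a b : (0 < a)%R ->
  measurable_fun [set: @LR R] (affine a b : LR -> @LR R).
Proof.
move=> a0 _ A /leb_measurableP mA; rewrite setTI; apply/leb_measurableP => X.
have ai0 : (0 < a^-1)%R by rewrite invr_gt0.
have -> : X = affine a b @^-1` (affine a b @` X).
  rewrite preimage_affine// image_comp (_ : _ \o _ = id) ?image_id//.
  by apply/funext => t /=; rewrite affineK// gt_eqF.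
rewrite preimage_setC -!preimage_setI !leb_preimage_affine// mA.
by rewrite ge0_muleDr// measure_ge0.
Qed.

Lemma leb_int_affine a b (D : set R) (f : R -> R) : (0 < a)%R ->
  measurable (D : set (@LR R)) -> leb_measurable D f ->
  (forall t, D t -> (0 <= f t)%R) ->
  leb_int (affine a b @^-1` D) (f \o affine a b) = a^-1%:E * leb_int D f.
Proof.
move=> a0 mD mf f0.
have ai0 : (0 <= a^-1)%R by rewrite invr_ge0 ltW.
have mEf : measurable_fun (D : set (@LR R)) (EFin \o f).
  exact/measurable_EFinP.
have := ge0_integral_pushforward (measurable_affine b a0) leb mD mEf.
rewrite /leb_int => <-; last by move=> y /[!inE] /f0; rewrite lee_fin.
rewrite (eq_measure_integral (mscale (NngNum ai0) leb)).
- by rewrite ge0_integral_mscale.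
- exact: measurable_affine.
- by move=> maff A mA AD; exact: leb_preimage_affine.
Qed.

Lemma leb_measurable_affine a b (D : set R) (f : R -> R) : (0 < a)%R ->
  measurable (D : set (@LR R)) -> leb_measurable D f ->
  leb_measurable (affine a b @^-1` D) (f \o affine a b).
Proof.
move=> a0 mD mf; apply: (measurable_comp mD _ mf).
  by move=> _ [t Dt <-].
exact: measurable_funTS (measurable_affine b a0).
Qed.

End affine_change_of_variables.

(** * Integration of nonnegative real functions against the completed measure *)

Section leb_integral.
Context {R : realType}.
Local Notation leb := (@completed_lebesgue_measure R).
Implicit Types (a b c : R) (A D : set R) (f e : R -> R).

Lemma borel_leb (A : set R) : measurable A -> measurable (A : set (@LR R)).
Proof. exact: sub_caratheodory. Qed.

Lemma leb_itv (i : interval R) : measurable ([set` i] : set (@LR R)).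
Proof. by apply: borel_leb; exact: measurable_itv. Qed.

Lemma borel_leb_measurable D f :
  measurable D -> measurable_fun D f -> leb_measurable D f.
Proof. by move=> mD mf _ B mB; apply: borel_leb; exact: mf. Qed.

(** The identity from the completed space to the Borel space is measurable and pushes [leb] forward
    to the Borel measure. This brings in library results such as the integral of [exponential_pdf]
    and the fundamental theorem of calculus. *)
Lemma leb_int_borel D f : measurable D -> measurable_fun D f ->
  (forall t, D t -> (0 <= f t)%R) ->
  leb_int D f = \int[lebesgue_measure]_(t in D) (f t)%:E.
Proof.
move=> mD mf f0.
have mid : measurable_fun [set: @LR R] (id : LR -> measurableTypeR R).
  by move=> _ B mB; rewrite setTI; exact: borel_leb.
have mEf : measurable_fun (D : set (measurableTypeR R)) (EFin \o f).
  exact/measurable_EFinP.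
have := ge0_integral_pushforward mid leb mD mEf.
rewrite /leb_int => <-; last by move=> y /[!inE] /f0; rewrite lee_fin.
by rewrite [LHS](eq_measure_integral lebesgue_measure).
Qed.

Lemma eq_leb_int D f f' : (forall t, D t -> f t = f' t) ->
  leb_int D f = leb_int D f'.
Proof. by move=> E; apply: eq_integral => t /[!inE] Dt; rewrite E. Qed.

Lemma eq_leb_measurable D f f' : (forall t, D t -> f t = f' t) ->
  leb_measurable D f -> leb_measurable D f'.
Proof. by move=> E; apply: eq_measurable_fun => t /[!inE] /E. Qed.

Lemma leb_int_ge0 D f : (forall t, D t -> (0 <= f t)%R) -> 0 <= leb_int D f.
Proof. by move=> f0; apply: integral_ge0 => t Dt; rewrite lee_fin f0. Qed.

Lemma leb_measurable_EFin D f : leb_measurable D f ->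
  measurable_fun (D : set (@LR R)) (fun t => (f t)%:E).
Proof. by move=> mf; exact/measurable_EFinP. Qed.

Lemma leb_measurable_dist D f f' : leb_measurable D f -> leb_measurable D f' ->
  leb_measurable D (fun t => `|f t - f' t|%R).
Proof.
move=> mf mf'; have mB := measurable_funB mf mf'.
exact: (measurableT_comp (@normr_measurable R setT) mB).
Qed.

Lemma leb_int_le D f f' : measurable (D : set (@LR R)) ->
  leb_measurable D f -> leb_measurable D f' ->
  (forall t, D t -> (0 <= f t <= f' t)%R) ->
  leb_int D f <= leb_int D f'.
Proof.
move=> /= mD /leb_measurable_EFin mf /leb_measurable_EFin mf' ff'.
apply: (@ge0_le_integral _ _ _ leb D mD _ _ _ mf mf') => t /ff' /andP[]; by rewrite lee_fin.
Qed.

Lemma leb_intD D f f' : measurable (D : set (@LR R)) ->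
  leb_measurable D f -> leb_measurable D f' ->
  (forall t, D t -> (0 <= f t)%R) -> (forall t, D t -> (0 <= f' t)%R) ->
  leb_int D (fun t => f t + f' t)%R = leb_int D f + leb_int D f'.
Proof.
move=> /= mD /leb_measurable_EFin mf /leb_measurable_EFin mf' f0 f'0.
by rewrite -(@ge0_integralD _ _ _ leb D mD _ _ _ mf _ mf').
Qed.

Lemma leb_int_leD D f f' e : measurable (D : set (@LR R)) ->
  leb_measurable D f -> leb_measurable D f' -> leb_measurable D e ->
  (forall t, D t -> (0 <= f t)%R) -> (forall t, D t -> (0 <= f' t)%R) ->
  (forall t, D t -> (0 <= e t)%R) -> (forall t, D t -> (f t <= f' t + e t)%R) ->
  leb_int D f <= leb_int D f' + leb_int D e.
Proof.
move=> mD mf mf' me f0 f'0 e0 fe; rewrite -leb_intD//; apply: (leb_int_le mD mf).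
  exact: measurable_funD.
by move=> t Dt; rewrite f0//= fe.
Qed.

Lemma leb_intZ D f c : measurable (D : set (@LR R)) ->
  leb_measurable D f -> (forall t, D t -> (0 <= f t)%R) -> (0 <= c)%R ->
  leb_int D (fun t => c * f t)%R = c%:E * leb_int D f.
Proof.
move=> /= mD /leb_measurable_EFin mf f0 c0.
by rewrite -(@ge0_integralZl_EFin _ _ _ leb D mD _ _ mf).
Qed.

Lemma leb_int_cst D c : measurable (D : set (@LR R)) ->
  leb_int D (fun=> c) = c%:E * leb D.
Proof. by move=> mD; rewrite /leb_int (integral_cst _ mD). Qed.

Lemma leb_int_setU A D f :
  measurable (A : set (@LR R)) -> measurable (D : set (@LR R)) ->
  leb_measurable (A `|` D) f -> (forall t, (A `|` D) t -> (0 <= f t)%R) ->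
  [disjoint A & D] -> leb_int (A `|` D) f = leb_int A f + leb_int D f.
Proof.
move=> /= mA mD /leb_measurable_EFin mf f0 AD.
exact: (ge0_integral_setU leb mA mD mf).
Qed.

Lemma leb_set1 a : leb [set a] = 0.
Proof. exact: lebesgue_measure_set1. Qed.

Lemma leb_co a b : (a <= b)%R -> leb `[a, b[ = (b - a)%:E.
Proof.
move=> ab; rewrite -[leb _]/(lebesgue_measure _) lebesgue_measure_itv/=.
rewrite lte_fin; case: ltP => // ba; have -> : a = b by apply/le_anti/andP.
by rewrite subrr.
Qed.

(** The dynamic programming identity integrates over a closed interval, whereas the cells of a step
    function are half-open; the endpoint is a null set. *)
Lemma leb_int_cc_co a b f : (a <= b)%R -> leb_measurable `[a, b] f ->
  (forall t, (a <= t <= b)%R -> (0 <= f t)%R) ->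
  leb_int `[a, b] f = leb_int `[a, b[ f.
Proof.
move=> ab mf f0.
have E : `[a, b]%classic = `[a, b[%classic `|` [set b].
  by rewrite setUitv1.
rewrite E leb_int_setU.
- suff -> : leb_int [set b] f = 0 by rewrite adde0.
  apply: null_set_integral.
  + by apply: borel_leb; exact: measurable_set1.
  + apply: leb_measurable_EFin; apply: measurable_funS mf; first exact: leb_itv.
    by rewrite E; exact: subsetUr.
  + exact: leb_set1.
- exact: leb_itv.
- by apply: borel_leb; exact: measurable_set1.
- by rewrite -E.
- by rewrite -E => t /=; rewrite in_itv/=; exact: f0.
- apply/disj_setPS => t [/=]; rewrite in_itv/= => /andP[_ + tb].
  by rewrite tb ltxx.
Qed.

Lemma leb_int_split T f : (0 <= T)%R -> leb_measurable `[0%R, +oo[ f ->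
  (forall t, (0 <= t)%R -> (0 <= f t)%R) ->
  leb_int `[0%R, +oo[ f = leb_int `[0%R, T[ f + leb_int `[T, +oo[ f.
Proof.
move=> T0 mf f0.
have E : `[0%R, +oo[%classic = `[0%R, T[%classic `|` `[T, +oo[%classic.
  apply/seteqP; split => t /=; rewrite !in_itv/= !andbT.
    by move=> ->; case: ltP => _; [left|right].
  by case=> [/andP[]//|]; exact: le_trans.
rewrite E leb_int_setU//; try exact: leb_itv.
- by rewrite -E.
- by rewrite -E => t /=; rewrite in_itv/= andbT; exact: f0.
- apply/disj_setPS => t [/=]; rewrite !in_itv/= andbT => /andP[_ + tb].
  by rewrite ltNge tb.
Qed.

Lemma preimage_shift T : affine 1 T @^-1` `[T, +oo[ = (`[0%R, +oo[%classic : set R).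
Proof.
by apply/seteqP; split=> t /=; rewrite !in_itv/= !andbT /affine mul1r lerDr.
Qed.

Lemma leb_int_shift T f : leb_measurable `[T, +oo[ f ->
  (forall t, (T <= t)%R -> (0 <= f t)%R) ->
  leb_int `[T, +oo[ f = leb_int `[0%R, +oo[ (fun t => f (t + T)%R).
Proof.
move=> mf f0; have := @leb_int_affine R 1 T `[T, +oo[ f ltr01 (leb_itv _) mf.
rewrite invr1 mul1e preimage_shift => <-.
  by apply: eq_leb_int => t _; rewrite /= /affine mul1r.
by move=> t /=; rewrite in_itv/= andbT; exact: f0.
Qed.

Lemma leb_measurable_shift T f : leb_measurable `[T, +oo[ f ->
  leb_measurable `[0%R, +oo[ (fun t => f (t + T)%R).
Proof.
move=> mf; have := @leb_measurable_affine R 1 T _ _ ltr01 (leb_itv _) mf; rewrite preimage_shift.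
by apply: eq_leb_measurable => t _; rewrite /= /affine mul1r.
Qed.

Lemma preimage_scale c : (0 < c)%R ->
  affine c 0 @^-1` `[0%R, +oo[ = (`[0%R, +oo[%classic : set R).
Proof.
move=> c0; apply/seteqP; split=> t /=; rewrite !in_itv/= !andbT /affine addr0;
  by rewrite pmulr_rge0.
Qed.

Lemma leb_int_scale c f : (0 < c)%R -> leb_measurable `[0%R, +oo[ f ->
  (forall t, (0 <= t)%R -> (0 <= f t)%R) ->
  leb_int `[0%R, +oo[ (fun t => f (c * t)%R) = c^-1%:E * leb_int `[0%R, +oo[ f.
Proof.
move=> c0 mf f0; have := @leb_int_affine R c 0 `[0%R, +oo[ f c0 (leb_itv _) mf.
rewrite preimage_scale// => <-.
  by apply: eq_leb_int => t _; rewrite /= /affine addr0.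
by move=> t /=; rewrite in_itv/= andbT; exact: f0.
Qed.

Lemma leb_measurable_scale c f : (0 < c)%R -> leb_measurable `[0%R, +oo[ f ->
  leb_measurable `[0%R, +oo[ (fun t => f (c * t)%R).
Proof.
move=> c0 mf; have := @leb_measurable_affine R c 0 _ _ c0 (leb_itv _) mf; rewrite preimage_scale//.
by apply: eq_leb_measurable => t _; rewrite /= /affine addr0.
Qed.

End leb_integral.

(* The integral of a nonnegative function is a supremum over simple functions,
   so the truncation [max(h - c, 0)] of a simple function [h <= f] compares the
   integrals of arbitrary [f] and [f']. *)
Section integral_without_measurability.
Context {d : measure_display} {K : measurableType d} {R : realType}.
Variable P : probability K R.
Implicit Types (f : K -> R) (a c : R).
Import HBNNSimple.

Lemma ge0_integral_mono f f' : (forall z, (0 <= f z)%R) ->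
  (forall z, (f z <= f' z)%R) ->
  \int[P]_z (f z)%:E <= \int[P]_z (f' z)%:E.
Proof.
move=> f0 ff'; rewrite !ge0_integralTE.
- apply: ereal_sup_le; apply: image_subset => h /= hf z.
  by apply: le_trans (hf z) _; rewrite lee_fin.
- by move=> z; rewrite lee_fin (le_trans (f0 z)).
- by move=> z; rewrite lee_fin.
Qed.

Lemma ge0_integral_leD f f' c : (forall z, (0 <= f z)%R) -> (0 <= c)%R ->
  (forall z, (0 <= f' z)%R) -> (forall z, (f z <= f' z + c)%R) ->
  \int[P]_z (f z)%:E <= \int[P]_z (f' z)%:E + c%:E.
Proof.
move=> f0 c0 f'0 ff'; rewrite ge0_integralTE; last by move=> z; rewrite lee_fin.
apply: ge_ereal_sup => _ [h hf <-].
pose h' z := Num.max (h z - c)%R 0%R.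
have mh : measurable_fun [set: K] h by [].
have mh' : measurable_fun [set: K] h'.
  apply: measurable_maxr => //; exact: measurable_funB.
have h'0 z : (0 <= h' z)%R by rewrite le_max lexx orbT.
have : \int[P]_z (h' z)%:E <= \int[P]_z (f' z)%:E.
  apply: ge0_integral_mono => // z; rewrite ge_max f'0 andbT lerBlDr.
  by apply: le_trans (ff' z); have := hf z; rewrite lee_fin.
move=> h'f'; apply: le_trans (leeD2r _ h'f').
have -> : c%:E = \int[P]_z (cst c%:E z).
  rewrite integral_cst// -[LHS]mule1; congr (_ * _).
  exact/esym/probability_setT.
rewrite -(integralT_nnsfun P h) -ge0_integralD//=.
- apply: ge0_le_integral => //.
  + by move=> z _; rewrite lee_fin.
  + exact/measurable_EFinP.
  + by apply: emeasurable_funD => //; exact/measurable_EFinP.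
  + by move=> z _; rewrite -EFinD lee_fin -lerBlDr le_max lexx.
- by move=> z _; rewrite lee_fin.
- exact/measurable_EFinP.
Qed.

Lemma ge0_integral_leZ f a : (forall z, (0 <= f z)%R) -> (0 < a)%R ->
  \int[P]_z (a * f z)%:E <= a%:E * \int[P]_z (f z)%:E.
Proof.
move=> f0 a0; rewrite ge0_integralTE; last first.
  by move=> z; rewrite lee_fin mulr_ge0// ltW.
apply: ge_ereal_sup => _ [h hf <-].
have mh : measurable_fun [set: K] h by [].
have : \int[P]_z (a^-1 * h z)%:E <= \int[P]_z (f z)%:E.
  apply: ge0_integral_mono => // z; first by rewrite mulr_ge0// invr_ge0 ltW.
  by rewrite ler_pdivrMl//; have := hf z; rewrite lee_fin.
rewrite -(@lee_pmul2l _ a%:E)//; apply: le_trans.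
rewrite -ge0_integralZl_EFin//; last 3 first.
- by move=> z _; rewrite lee_fin mulr_ge0// invr_ge0 ltW.
- by apply/measurable_EFinP; exact: measurable_funM.
- exact: ltW.
rewrite -(integralT_nnsfun P h) le_eqVlt; apply/orP; left; apply/eqP.
by apply: eq_integral => z _; rewrite /= -EFinM mulrA divff ?gt_eqF// mul1r.
Qed.

Lemma ge0_integralZ f a : (forall z, (0 <= f z)%R) -> (0 < a)%R ->
  \int[P]_z (a * f z)%:E = a%:E * \int[P]_z (f z)%:E.
Proof.
move=> f0 a0; apply/eqP; rewrite eq_le ge0_integral_leZ//=.
have ai0 : (0 < a^-1)%R by rewrite invr_gt0.
have := @ge0_integral_leZ (fun z => a * f z)%R a^-1 _ ai0.
rewrite lee_pdivlMl//.
under eq_integral do rewrite mulrA mulVf ?gt_eqF// mul1r.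
by apply=> z; rewrite mulr_ge0// ltW.
Qed.

End integral_without_measurability.

(** * The sup-inf of expectations as an operator on payoffs *)

Section stage_value.
Context {R : realType} {Omega : Type} {d : measure_display}.
Context {K : measurableType d} {L M : Omega -> Type}.
Variable P : forall w : Omega, L w -> M w -> probability K R.
Hypothesis inhL : forall w, inhabited (L w).
Hypothesis inhM : forall w, inhabited (M w).
Implicit Types (f : K -> R) (a c : R) (w : Omega).

Definition estage w f : \bar R :=
  ereal_sup (range (fun l : L w =>
    ereal_inf (range (fun m : M w => \int[P l m]_z (f z)%:E)))).

(** Real-valued form, faithful for bounded nonnegative [f] by [estage_fin], so that errors can be
    estimated in [R]. *)
Definition stage w f : R := fine (estage w f).

Lemma estage_leD w f f' c : (forall z, (0 <= f z)%R) -> (0 <= c)%R ->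
  (forall z, (0 <= f' z)%R) -> (forall z, (f z <= f' z + c)%R) ->
  estage w f <= estage w f' + c%:E.
Proof.
move=> f0 c0 f'0 ff'; apply: ge_ereal_sup => _ [l _ <-].
rewrite -leeBlDr//; apply: le_trans (ereal_sup_ubound _); last by exists l.
apply: le_ereal_inf_tmp => _ [m _ <-]; rewrite leeBlDr//.
apply: le_trans (ge0_integral_leD (P l m) f0 c0 f'0 ff').
by apply: ereal_inf_lbound; exists m.
Qed.

Lemma estageZ w f a : (forall z, (0 <= f z)%R) -> (0 < a)%R ->
  estage w (fun z => a * f z)%R = a%:E * estage w f.
Proof.
have le b g : (forall z, (0 <= g z)%R) -> (0 < b)%R ->
    estage w (fun z => b * g z)%R <= b%:E * estage w g.
  move=> g0 b0; apply: ge_ereal_sup => _ [l _ <-].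
  rewrite -lee_pdivrMl//; apply: le_trans (ereal_sup_ubound _); last by exists l.
  apply: le_ereal_inf_tmp => _ [m _ <-]; rewrite lee_pdivrMl// -ge0_integralZ//.
  by apply: ereal_inf_lbound; exists m.
move=> f0 a0; apply/eqP; rewrite eq_le le//= -lee_pdivlMl//.
have -> : estage w f = estage w (fun z => a^-1 * (a * f z))%R.
  by congr estage; apply/funext => z; rewrite mulrA mulVf ?gt_eqF// mul1r.
by apply: le; rewrite ?invr_gt0// => z; rewrite mulr_ge0// ltW.
Qed.

Lemma estage_bound w f c : (forall z, (0 <= f z <= c)%R) ->
  0 <= estage w f <= c%:E.
Proof.
move=> f0c; have f0 z : (0 <= f z)%R by have /andP[] := f0c z.
have [l] := inhL w; have [m] := inhM w.
have c0 : (0 <= c)%R by have /andP[] := f0c point; exact: le_trans.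
apply/andP; split.
  apply: le_trans (ereal_sup_ubound _); last by exists l.
  apply: le_ereal_inf_tmp => _ [m' _ <-]; apply: integral_ge0 => z _.
  by rewrite lee_fin.
apply: ge_ereal_sup => _ [l' _ <-].
apply: le_trans (ereal_inf_lbound _) _; first by exists m.
rewrite -[leRHS]add0e -(integral0 (P l' m) setT).
by apply: ge0_integral_leD => // z; rewrite add0r; have /andP[] := f0c z.
Qed.

Lemma estage_fin w f c : (forall z, (0 <= f z <= c)%R) ->
  estage w f = (stage w f)%:E.
Proof.
move=> /(estage_bound w) /andP[s0 sc]; rewrite /stage fineK//.
by rewrite ge0_fin_numE// (le_lt_trans sc)// ltry.
Qed.

Lemma stage_leD w f f' B B' c : (0 <= c)%R ->
  (forall z, (0 <= f z <= B)%R) -> (forall z, (0 <= f' z <= B')%R) ->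
  (forall z, (f z <= f' z + c)%R) -> (stage w f <= stage w f' + c)%R.
Proof.
move=> c0 fB f'B ff'.
rewrite -lee_fin EFinD -(estage_fin w fB) -(estage_fin w f'B).
apply: estage_leD => // z; first by have /andP[] := fB z.
by have /andP[] := f'B z.
Qed.

(** Nonexpansiveness in the sup norm; with [stageZ] it carries all error estimates below. The bounds
    [B] and [B'] serve to make both values finite. *)
Lemma stage_lipschitz w f f' B B' c :
  (forall z, (0 <= f z <= B)%R) -> (forall z, (0 <= f' z <= B')%R) ->
  (forall z, (`|f z - f' z| <= c)%R) -> (`|stage w f - stage w f'| <= c)%R.
Proof.
move=> fB f'B ff'; have c0 : (0 <= c)%R by exact: le_trans (ff' point).
rewrite ler_norml lerBrDr lerBlDr; apply/andP; split.
  rewrite addrC lerBlDr; apply: stage_leD fB _ => // z.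
  by have := ff' z; rewrite ler_norml => /andP[]; lra.
rewrite addrC; apply: stage_leD f'B _ => // z.
by have := ff' z; rewrite ler_norml => /andP[]; lra.
Qed.

Lemma stageZ w f B a : (forall z, (0 <= f z <= B)%R) -> (0 < a)%R ->
  stage w (fun z => a * f z)%R = (a * stage w f)%R.
Proof.
move=> fB a0; apply/EFin_inj; rewrite EFinM -(estage_fin w fB).
rewrite -(@estage_fin _ _ (a * B)); last first.
  move=> z; have /andP[f0 fB'] := fB z.
  by rewrite mulr_ge0 ?(ltW a0)//= ler_pM2l.
by apply: estageZ => // z; have /andP[] := fB z.
Qed.

Lemma eq_stage w f f' : f =1 f' -> stage w f = stage w f'.
Proof. by move=> /funext->. Qed.

End stage_value.

(** * Nonnegative integrable weights: mass, tails, multiples, rescalings *)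

Section weights.
Context {R : realType}.
Implicit Types (rho : R -> R) (T c t : R).
Local Notation Rp := `[0%R, +oo[%classic.

(** Tails of densities are not densities. The value is therefore studied on all nonnegative
    integrable functions, where it is homogeneous. *)
Definition weight rho : Prop :=
  [/\ leb_measurable Rp rho, (forall t, (0 <= t)%R -> (0 <= rho t)%R) &
      leb_int Rp rho < +oo].

Definition mass rho : R := fine (leb_int Rp rho).

Lemma Rp_ge0 t : Rp t -> (0 <= t)%R.
Proof. by rewrite /= in_itv/= andbT. Qed.

Lemma leb_Rp : measurable (Rp : set (@LR R)).
Proof. exact: leb_itv. Qed.

Lemma massE rho : weight rho -> leb_int Rp rho = (mass rho)%:E.
Proof.
move=> [_ rho0 rhoy]; rewrite /mass fineK// ge0_fin_numE//.
by apply: leb_int_ge0 => t /Rp_ge0; exact: rho0.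
Qed.

Lemma mass_ge0 rho : weight rho -> (0 <= mass rho)%R.
Proof.
move=> wrho; rewrite -lee_fin -massE//; case: wrho => _ rho0 _.
by apply: leb_int_ge0 => t /Rp_ge0; exact: rho0.
Qed.

Lemma density_weight rho : is_density rho -> weight rho.
Proof. by move=> [m p i]; split => //; rewrite i ltry. Qed.

Lemma mass_density rho : is_density rho -> mass rho = 1%R.
Proof. by move=> [_ _ i]; rewrite /mass i. Qed.

Lemma eq_weight rho rho' : (forall t, (0 <= t)%R -> rho t = rho' t) ->
  weight rho -> weight rho'.
Proof.
move=> E [m p i]; split.
- by apply: eq_leb_measurable m => t /Rp_ge0; exact: E.
- by move=> t t0; rewrite -E// p.
- by rewrite -(@eq_leb_int _ _ rho)// => t /Rp_ge0; exact: E.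
Qed.

Lemma eq_mass rho rho' : (forall t, (0 <= t)%R -> rho t = rho' t) ->
  mass rho = mass rho'.
Proof.
by move=> E; rewrite /mass (@eq_leb_int _ _ rho rho')// => t /Rp_ge0; exact: E.
Qed.

Lemma weightZ c rho : (0 <= c)%R -> weight rho ->
  weight (fun t => c * rho t)%R /\ mass (fun t => c * rho t)%R = (c * mass rho)%R.
Proof.
move=> c0 wrho; have [m p i] := wrho.
have E : leb_int Rp (fun t => c * rho t)%R = (c * mass rho)%:E.
  rewrite leb_intZ ?massE ?EFinM//; first exact: leb_Rp.
  by move=> t /Rp_ge0; exact: p.
split; last by rewrite /mass E.
split; last by rewrite E ltry.
- exact: measurable_funM.
- by move=> t t0; rewrite mulr_ge0// p.
Qed.

Lemma leb_measurable_tail rho T : (0 <= T)%R -> leb_measurable Rp rho ->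
  leb_measurable `[T, +oo[ rho.
Proof.
move=> T0; apply: measurable_funS; first exact: leb_Rp.
by move=> t /=; rewrite !in_itv/= !andbT; exact: le_trans.
Qed.

Lemma leb_measurable_head rho T : leb_measurable Rp rho ->
  leb_measurable `[0%R, T[ rho.
Proof.
apply: measurable_funS; first exact: leb_Rp.
by move=> t /=; rewrite !in_itv/= => /andP[->].
Qed.

Lemma leb_int_head_le rho T : (0 <= T)%R -> leb_measurable Rp rho ->
  (forall t, (0 <= t)%R -> (0 <= rho t)%R) ->
  leb_int `[0%R, T[ rho <= leb_int Rp rho.
Proof.
move=> T0 m p; rewrite (leb_int_split T0 m p) leeDl//.
apply: leb_int_ge0 => t /=; rewrite in_itv/= andbT => Tt; apply: p.
exact: le_trans Tt.
Qed.

Lemma leb_int_tail rho T : (0 <= T)%R -> leb_measurable Rp rho ->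
  (forall t, (0 <= t)%R -> (0 <= rho t)%R) ->
  leb_int `[T, +oo[ rho = leb_int Rp (fun t => rho (t + T)%R).
Proof.
move=> T0 m p; rewrite leb_int_shift//; first exact: leb_measurable_tail.
by move=> t Tt; apply: p; exact: le_trans Tt.
Qed.

Lemma weight_shift rho T : (0 <= T)%R -> weight rho ->
  weight (fun t => rho (t + T)%R).
Proof.
move=> T0 wrho; have [m p i] := wrho; split.
- by apply: leb_measurable_shift; exact: leb_measurable_tail.
- by move=> t t0; rewrite p// addr_ge0.
- rewrite -(leb_int_tail T0 m p); apply: le_lt_trans i.
  rewrite (leb_int_split T0 m p) leeDr//.
  by apply: leb_int_ge0 => t /=; rewrite in_itv/= => /andP[t0 _]; exact: p.
Qed.

Lemma mass_split rho T : (0 <= T)%R -> weight rho ->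
  leb_int `[0%R, T[ rho = (mass rho - mass (fun t => rho (t + T)%R))%:E.
Proof.
move=> T0 wrho; have ws := weight_shift T0 wrho; have [m p i] := wrho.
have := leb_int_split T0 m p; rewrite (leb_int_tail T0 m p) !massE// => E.
by rewrite EFinB E addeK.
Qed.

Lemma weight_scale rho c : (0 < c)%R -> weight rho ->
  weight (scale_density rho c) /\ mass (scale_density rho c) = mass rho.
Proof.
move=> c0 wrho; have [m p i] := wrho.
have ms := leb_measurable_scale c0 m.
have ps t : (0 <= t)%R -> (0 <= rho (c * t))%R.
  by move=> t0; rewrite p// mulr_ge0// ltW.
have E : leb_int Rp (scale_density rho c) = (mass rho)%:E.
  rewrite leb_intZ ?(ltW c0)//; first last.
  - by move=> t /Rp_ge0; exact: ps.
  - exact: leb_Rp.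
  by rewrite leb_int_scale// massE// -!EFinM mulrA divff ?gt_eqF// mul1r.
split; last by rewrite /mass E.
split; last by rewrite E ltry.
- exact: measurable_funM.
- by move=> t t0; rewrite mulr_ge0 ?(ltW c0)// ps.
Qed.

Lemma weight_density rho : weight rho -> mass rho = 1%R -> is_density rho.
Proof. by move=> wrho m1; case: (wrho) => m p _; split=> //; rewrite massE// m1. Qed.

End weights.

(** * The value as a functional of the weight, and dynamic programming for weights *)

Section game_value.
Context {R : realType} {Omega : Type} {d : measure_display}.
Context {K : measurableType d} (ev : K -> R -> Omega) (g : Omega -> R).
Context (L M : Omega -> Type)
        (P : forall w : Omega, L w -> M w -> probability K R).
Hypothesis g01 : forall w, (0 <= g w <= 1)%R.
Hypothesis mg : forall z, leb_measurable `[0%R, +oo[ (fun t => g (ev z t)).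
Hypothesis inhL : forall w, inhabited (L w).
Hypothesis inhM : forall w, inhabited (M w).
Hypothesis dp : forall rho w (n : nat), is_density rho ->
  dp_identity ev g P rho w n.+1%:R.
Implicit Types (rho : R -> R) (T c t : R) (z : K) (w : Omega).
Local Notation Rp := `[0%R, +oo[%classic.
Local Notation value := (value ev g P).
Local Notation payoff := (payoff ev g).

Lemma g_ge0 w : (0 <= g w)%R. Proof. by have /andP[] := g01 w. Qed.
Lemma g_le1 w : (g w <= 1)%R. Proof. by have /andP[] := g01 w. Qed.

Definition pay rho z : R := fine (payoff rho z).
Definition rvalue rho w : R := fine (value rho w).
Definition head_pay (n : nat) rho z : R :=
  fine (leb_int `[0%R, n%:R[ (fun t => rho t * g (ev z t))%R).

Lemma eq_value rho rho' : (forall t, (0 <= t)%R -> rho t = rho' t) ->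
  value rho = value rho'.
Proof.
move=> E; have -> // : value rho = value rho'.
rewrite /Defs.value; suff -> : payoff rho = payoff rho' by [].
by apply/funext => z; apply: eq_leb_int => t /Rp_ge0 /E ->.
Qed.

Lemma leb_measurable_pay rho z : weight rho ->
  leb_measurable Rp (fun t => rho t * g (ev z t))%R.
Proof. by move=> [m _ _]; exact: (measurable_funM m (mg z)). Qed.

Lemma pay_integrand_ge0 rho z t : weight rho -> Rp t ->
  (0 <= rho t * g (ev z t))%R.
Proof. by move=> [_ p _] /Rp_ge0 t0; rewrite mulr_ge0// ?p// g_ge0. Qed.

Lemma payoff_bound rho z : weight rho -> 0 <= payoff rho z <= (mass rho)%:E.
Proof.
move=> wrho; rewrite leb_int_ge0/=; last first.
  by move=> t; exact: pay_integrand_ge0.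
rewrite -massE//; have [m p _] := wrho; apply: leb_int_le => //.
- exact: leb_Rp.
- exact: leb_measurable_pay.
- move=> t Rt; rewrite pay_integrand_ge0//=.
  by rewrite ler_piMr ?g_le1// p// Rp_ge0.
Qed.

Lemma payoffE rho z : weight rho -> payoff rho z = (pay rho z)%:E.
Proof.
move=> /(payoff_bound z) /andP[p0 pm]; rewrite /pay fineK// ge0_fin_numE//.
by rewrite (le_lt_trans pm)// ltry.
Qed.

Lemma pay_bound rho : weight rho -> forall z, (0 <= pay rho z <= mass rho)%R.
Proof. by move=> wrho z; rewrite -!lee_fin -payoffE// payoff_bound. Qed.

Lemma value_estage rho w : weight rho -> value rho w = estage P w (pay rho).
Proof.
move=> wrho; rewrite /Defs.value /estage.
suff -> : payoff rho = (fun z => (pay rho z)%:E) by [].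
by apply/funext => z; rewrite payoffE.
Qed.

Lemma rvalue_stage rho w : weight rho -> rvalue rho w = stage P w (pay rho).
Proof. by move=> wrho; rewrite /rvalue value_estage. Qed.

Lemma valueE rho w : weight rho -> value rho w = (rvalue rho w)%:E.
Proof.
move=> wrho; rewrite value_estage// rvalue_stage//.
exact: (estage_fin P inhL inhM w (pay_bound wrho)).
Qed.

Lemma rvalue_bound rho w : weight rho -> (0 <= rvalue rho w <= mass rho)%R.
Proof.
move=> wrho; rewrite -!lee_fin -valueE// value_estage//.
exact: (estage_bound P inhL inhM w (pay_bound wrho)).
Qed.

Lemma pay_leD rho rho' c z : weight rho -> weight rho' ->
  leb_int Rp (fun t => `|rho t - rho' t|)%R <= c%:E ->
  (pay rho z <= pay rho' z + c)%R.
Proof.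
move=> wr wr' rc; rewrite -lee_fin EFinD -!payoffE//.
have [[m _ _] [m' p' _]] := (wr, wr').
apply: le_trans (leeD2l _ rc).
apply: leb_int_leD; first exact: leb_Rp.
- exact: leb_measurable_pay.
- exact: leb_measurable_pay.
- exact: leb_measurable_dist.
- by move=> t; exact: pay_integrand_ge0.
- by move=> t; exact: pay_integrand_ge0.
- by [].
- move=> t Rt; have t0 := Rp_ge0 Rt.
  rewrite -lerBlDl -mulrBl; apply: le_trans (ler_norm _) _.
  by rewrite normrM ler_piMr// ger0_norm ?g_ge0// g_le1.
Qed.

(** Since [0 <= g <= 1], the payoffs along every trajectory differ by at most the L^1 distance, and
    [stage] is nonexpansive. This is what allows a density to be replaced by a step function. *)
Lemma rvalue_lipschitz rho rho' c w : weight rho -> weight rho' ->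
  leb_int Rp (fun t => `|rho t - rho' t|)%R <= c%:E ->
  (`|rvalue rho w - rvalue rho' w| <= c)%R.
Proof.
move=> wr wr' rc; rewrite !rvalue_stage//.
apply: (stage_lipschitz P inhL inhM w (pay_bound wr) (pay_bound wr')) => z.
have h1 := pay_leD z wr wr' rc.
have h2 : (pay rho' z <= pay rho z + c)%R.
  apply: pay_leD => //; apply: le_trans rc.
  by rewrite (@eq_leb_int _ _ _ (fun t => `|rho t - rho' t|)%R)// => t _;
    rewrite distrC.
by rewrite ler_norml; apply/andP; split; lra.
Qed.

Lemma payZ c rho z : (0 <= c)%R -> weight rho ->
  pay (fun t => c * rho t)%R z = (c * pay rho z)%R.
Proof.
move=> c0 wr; have [wc _] := weightZ c0 wr.
apply/EFin_inj; rewrite EFinM -!payoffE//.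
rewrite /Defs.payoff -leb_intZ//.
- by apply: eq_leb_int => t _; rewrite mulrA.
- exact: leb_Rp.
- exact: leb_measurable_pay.
- by move=> t; exact: pay_integrand_ge0.
Qed.

Lemma rvalueZ c rho w : (0 < c)%R -> weight rho ->
  rvalue (fun t => c * rho t)%R w = (c * rvalue rho w)%R.
Proof.
move=> c0 wr; have [wc _] := weightZ (ltW c0) wr.
rewrite !rvalue_stage// -(stageZ P inhL inhM w (pay_bound wr) c0).
by apply: eq_stage => z; rewrite payZ// ltW.
Qed.

Lemma head_bound n rho z : weight rho ->
  0 <= leb_int `[0%R, n%:R[ (fun t => rho t * g (ev z t))%R <= (mass rho)%:E.
Proof.
move=> wr; rewrite leb_int_ge0/=; last first.
  move=> t /=; rewrite in_itv/= => /andP[t0 _].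
  by apply: pay_integrand_ge0 => //=; rewrite in_itv/= t0.
apply: (@le_trans _ _ (payoff rho z)).
  apply: leb_int_head_le => //; first exact: leb_measurable_pay.
  by move=> t t0; apply: pay_integrand_ge0 => //=; rewrite in_itv/= t0.
by have /andP[] := payoff_bound z wr.
Qed.

Lemma head_payE n rho z : weight rho ->
  leb_int `[0%R, n%:R[ (fun t => rho t * g (ev z t))%R = (head_pay n rho z)%:E.
Proof.
move=> /(head_bound n z) /andP[p0 pm]; rewrite /head_pay fineK// ge0_fin_numE//.
by rewrite (le_lt_trans pm)// ltry.
Qed.

Lemma head_pay_bound n rho z : weight rho -> (0 <= head_pay n rho z <= mass rho)%R.
Proof. by move=> wr; rewrite -!lee_fin -head_payE// head_bound. Qed.

Lemma head_payZ n c rho z : (0 <= c)%R -> weight rho ->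
  head_pay n (fun t => c * rho t)%R z = (c * head_pay n rho z)%R.
Proof.
move=> c0 wr; have [wc _] := weightZ c0 wr.
apply/EFin_inj; rewrite EFinM -!head_payE// -leb_intZ//.
- by apply: eq_leb_int => t _; rewrite mulrA.
- exact: leb_itv.
- by apply: leb_measurable_head; exact: leb_measurable_pay.
- move=> t /=; rewrite in_itv/= => /andP[t0 _].
  by apply: pay_integrand_ge0 => //=; rewrite in_itv/= t0.
Qed.

Lemma rvalue_dp_density rho n w : is_density rho ->
  rvalue rho w = stage P w (fun z => head_pay n.+1 rho z +
                     rvalue (fun t => rho (t + n.+1%:R)) (ev z n.+1%:R))%R.
Proof.
move=> dr; have wr := density_weight dr.
have ws : weight (fun t => rho (t + n.+1%:R)%R) by exact: weight_shift.
rewrite /rvalue (dp w n dr) /stage /estage.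
suff -> : (fun z => leb_int `[0%R, n.+1%:R] (fun t => rho t * g (ev z t))%R
    + value (fun t => rho (t + n.+1%:R)%R) (ev z n.+1%:R)) =
  (fun z => (head_pay n.+1 rho z + fine (value (fun t => rho (t + n.+1%:R)%R)
    (ev z n.+1%:R)))%:E) by [].
apply/funext => z; rewrite EFinD -head_payE// leb_int_cc_co//.
- by rewrite valueE.
- apply: measurable_funS (leb_measurable_pay z wr); first exact: leb_Rp.
  by move=> t /=; rewrite !in_itv/= => /andP[->].
- move=> t /andP[t0 _].
  by apply: pay_integrand_ge0 => //=; rewrite in_itv/= t0.
Qed.

(** The identity is given for densities. A weight of positive mass is normalised, and the
    homogeneity of head payoff, value and stage operator removes the factor again. *)
Lemma rvalue_dp rho n w : weight rho -> (0 < mass rho)%R ->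
  rvalue rho w = stage P w (fun z => head_pay n.+1 rho z +
                     rvalue (fun t => rho (t + n.+1%:R)) (ev z n.+1%:R))%R.
Proof.
move=> wr m0; have mi0 : (0 < (mass rho)^-1)%R by rewrite invr_gt0.
have [wc mc] := weightZ (ltW mi0) wr.
have ws : weight (fun t => rho (t + n.+1%:R)%R) by exact: weight_shift.
have dc : is_density (fun t => (mass rho)^-1 * rho t)%R.
  by apply: weight_density => //; rewrite mc mulVf// gt_eqF.
apply: (@mulfI _ (mass rho)^-1%R); first exact: lt0r_neq0.
rewrite -rvalueZ// (rvalue_dp_density n w dc).
rewrite -(@stageZ _ _ _ _ _ _ P inhL inhM w _
           (mass rho + mass (fun t => rho (t + n.+1%:R)))%R _ _ mi0).
  apply: eq_stage => z; rewrite head_payZ ?(ltW mi0)// mulrDr; congr (_ + _)%R.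
  exact: rvalueZ.
move=> z; have /andP[h0 h1] := head_pay_bound n.+1 z wr.
have /andP[v0 v1] := rvalue_bound (ev z n.+1%:R) ws.
by rewrite addr_ge0//= lerD.
Qed.

End game_value.

(** * Integrals over an initial interval, and step functions *)

Section head_integrals.
Context {R : realType}.
Local Open Scope ring_scope.
Implicit Types (f u : R -> R) (T c e : R).

Lemma leb_int_head_fin T f c : 0 <= T -> leb_measurable `[0, T[ f ->
  (forall t, 0 <= t < T -> 0 <= f t <= c) ->
  leb_int `[0, T[ f = (fine (leb_int `[0, T[ f))%:E /\
  0 <= fine (leb_int `[0, T[ f) <= c * T.
Proof.
move=> T0 mf fc.
have le : (0 <= leb_int `[0%R, T[ f <= (c * T)%:E)%E.
  rewrite leb_int_ge0/=; last by move=> t /=; rewrite in_itv/= => /fc /andP[].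
  rewrite EFinM -[X in (_ <= _ * X%:E)%E]subr0 -leb_co// -leb_int_cst; last first.
    exact: leb_itv.
  apply: leb_int_le; [exact: leb_itv|exact: mf|exact: measurable_cst|].
  by move=> t /=; rewrite in_itv/= => /fc.
have fin : leb_int `[0, T[ f \is a fin_num.
  by case/andP: le => p0 pm; rewrite ge0_fin_numE// (le_lt_trans pm)// ltry.
by rewrite fineK//; split=> //; rewrite -!lee_fin fineK.
Qed.

(** Replaces a nearly constant density by the constant under the integral. It is applied with [u]
    equal to [g] along a trajectory for payoffs, and with [u = 1] for masses. *)
Lemma head_approx T f u c e : 0 <= T -> 0 <= c ->
  leb_measurable `[0, T[ f -> leb_measurable `[0, T[ u ->
  (forall t, 0 <= t < T -> 0 <= f t) ->
  (forall t, 0 <= t < T -> 0 <= u t <= 1) ->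
  (forall t, 0 <= t < T -> `|f t - c| <= e) ->
  `|fine (leb_int `[0, T[ (fun t => f t * u t)) - c * fine (leb_int `[0, T[ u)|
    <= e * T.
Proof.
move=> T0 c0 mf mu f0 u1 fc.
(* For [T = 0] the interval is empty and nothing forces [0 <= e], so this case is separate. *)
have [T00|Tpos] := eqVneq T 0.
  have E0 : `[0, T[%classic = set0 :> set R.
    apply/seteqP; split=> // t /=; rewrite in_itv/= T00.
    by case/andP => t0 /(le_lt_trans t0); rewrite ltxx.
  by rewrite E0 /leb_int !integral_set0 /= mulr0 subr0 normr0 T00 mulr0.
have e0 : 0 <= e.
  by apply: le_trans (fc 0 _); rewrite // lexx/= lt_neqAle eq_sym Tpos.
have mD : measurable (`[0, T[%classic : set (@LR R)) by exact: leb_itv.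
have mfu : leb_measurable `[0, T[ (fun t => f t * u t).
  exact: (measurable_funM mf mu).
have mcu : leb_measurable `[0, T[ (fun t => c * u t).
  exact: (measurable_funM (measurable_cst c) mu).
have me : leb_measurable `[0, T[ (cst e) by exact: measurable_cst.
have fu0 t : 0 <= t < T -> 0 <= f t * u t.
  by move=> tT; rewrite mulr_ge0 ?f0//; case/andP: (u1 _ tT).
have cu0 t : 0 <= t < T -> 0 <= c * u t.
  by move=> tT; rewrite mulr_ge0//; case/andP: (u1 _ tT).
have dev t : 0 <= t < T -> `|f t * u t - c * u t| <= e.
  move=> tT; have /andP[u0 u1'] := u1 _ tT.
  rewrite -mulrBl normrM (ger0_norm u0).
  by apply: le_trans (fc _ tT); rewrite ler_piMr.
have fuc t : 0 <= t < T -> 0 <= f t * u t <= c + e.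
  move=> tT; rewrite fu0//=; have := dev _ tT; rewrite ler_norml => /andP[_ ?].
  have /andP[u0 u1'] := u1 _ tT.
  have : c * u t <= c by rewrite ler_piMr.
  by lra.
have [Efu _] := leb_int_head_fin T0 mfu fuc.
have [Eu _] := leb_int_head_fin T0 mu u1.
have Ec : leb_int `[0, T[ (fun t => c * u t) =
    (c * fine (leb_int `[0, T[ u))%:E.
  rewrite leb_intZ// ?EFinM -?Eu//.
  by move=> t /=; rewrite in_itv/= => /u1 /andP[].
have Ee : leb_int `[0, T[ (cst e) = (e * T)%:E.
  by rewrite leb_int_cst// leb_co// subr0 EFinM.
rewrite ler_norml; apply/andP; split.
- rewrite lerBrDr addrC lerBlDr -lee_fin EFinD -Efu -Ee -Ec.
  apply: (leb_int_leD mD mcu mfu me) => t /=; rewrite in_itv/= => tT.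
  + exact: cu0.
  + exact: fu0.
  + by [].
  + by have := dev _ tT; rewrite ler_norml => /andP[]; lra.
- rewrite lerBlDr addrC -lee_fin EFinD -Efu -Ee -Ec.
  apply: (leb_int_leD mD mfu mcu me) => t /=; rewrite in_itv/= => tT.
  + exact: fu0.
  + exact: cu0.
  + by [].
  + by have := dev _ tT; rewrite ler_norml => /andP[]; lra.
Qed.

(** The entries of [p] are the masses of consecutive cells of length [T], hence the division by [T].
    Dropping the head of [p] corresponds to a time shift by [T], the form in which dynamic
    programming produces the tail. *)
Fixpoint step T (p : seq R) (t : R) : R :=
  if p is x :: q then (if t < T then x / T else step T q (t - T)) else 0.

Lemma measurable_step T p : measurable_fun setT (step T p).
Proof.
elim: p => [|x q IH] /=; first exact: measurable_cst.
apply: measurable_fun_ifT.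
- by apply: measurable_fun_ltr.
- exact: measurable_cst.
- by apply: (measurableT_comp IH); exact: measurable_funB.
Qed.

Lemma step_ge0 T p t : 0 < T -> all (>= 0) p -> 0 <= step T p t.
Proof.
move=> T0; elim: p t => [|x q IH] t //= /andP[x0 q0].
by case: ifPn => _; [rewrite divr_ge0// ltW|exact: IH].
Qed.

Lemma step_shift T x q t : 0 <= t -> step T (x :: q) (t + T) = step T q t.
Proof. by move=> t0 /=; rewrite ltNge lerDr t0/= addrK. Qed.

Lemma weight_step T p : 0 < T -> all (>= 0) p ->
  weight (step T p) /\ mass (step T p) = \sum_(x <- p) x.
Proof.
move=> T0 p0.
have ms q : leb_measurable `[0, +oo[ (step T q).
  apply: borel_leb_measurable; first exact: measurable_itv.
  exact: measurable_funTS (measurable_step T q).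
suff E : leb_int `[0, +oo[ (step T p) = (\sum_(x <- p) x)%:E.
  split; last by rewrite /mass E.
  by split=> //; [move=> t _; exact: step_ge0|rewrite E ltry].
elim: p p0 => [_|x q IH /andP[x0 q0]].
  by rewrite big_nil /leb_int integral0_eq.
have xq0 : all (>= 0) (x :: q) by rewrite /= x0.
rewrite big_cons EFinD -IH// (leb_int_split (ltW T0))//; last first.
  by move=> t _; exact: step_ge0.
congr (_ + _)%E.
- rewrite (@eq_leb_int _ _ _ (fun=> x / T)); last first.
    by move=> t /=; rewrite in_itv/= => /andP[_ ->].
  rewrite leb_int_cst ?leb_co ?subr0 ?(ltW T0)//; last exact: leb_itv.
  by rewrite -EFinM divfK// gt_eqF.
- rewrite leb_int_tail ?(ltW T0)//; last by move=> t _; exact: step_ge0.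
  by apply: eq_leb_int => t /Rp_ge0; exact: step_shift.
Qed.

End head_integrals.

(** * The one-step relation and its iteration over cells *)

Section dynamics.
Context {R : realType} {Omega : Type} {d : measure_display}.
Context {K : measurableType d} (ev : K -> R -> Omega) (g : Omega -> R).
Context (L M : Omega -> Type)
        (P : forall w : Omega, L w -> M w -> probability K R).
Hypothesis g01 : forall w, (0 <= g w <= 1)%R.
Hypothesis mg : forall z, leb_measurable `[0%R, +oo[ (fun t => g (ev z t)).
Hypothesis inhL : forall w, inhabited (L w).
Hypothesis inhM : forall w, inhabited (M w).
Hypothesis dp : forall rho w (n : nat), is_density rho ->
  dp_identity ev g P rho w n.+1%:R.
Variable U : Omega -> R.
Hypothesis U01 : forall w, (0 <= U w <= 1)%R.
Local Open Scope ring_scope.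
Local Notation V := (rvalue ev g P).
Implicit Types (mu : R -> R) (w : Omega) (z : K).

Definition converges_to_U mu := forall eps, 0 < eps ->
  exists2 l0, 0 < l0 & forall l, 0 < l < l0 ->
    forall w, `|V (scale_density mu l) w - U w| <= eps.

(* The common feature of the uniform, exponential and power densities: the tail
   after time [s] is a multiple of a rescaling of the density itself. *)
Record self_similar mu (a C s0 k1 : R) (m k : R -> R) : Prop := SelfSimilar {
  ss_density : is_density mu;
  ss_a : 0 < a;
  ss_C : 0 <= C;
  ss_s0 : 0 < s0;
  ss_m : forall s, 0 < s <= s0 -> 0 < m s;
  ss_k : forall s, 0 < s <= s0 -> 0 < k s <= k1;
  ss_tail : forall s t, 0 < s <= s0 -> 0 <= t ->
    mu (t + s) = m s * scale_density mu (k s) t;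
  ss_near0 : forall t, 0 <= t <= s0 -> `|mu t - a| <= C * t }.

Definition occ (n : nat) z : R :=
  fine (leb_int `[0, n%:R[ (fun t => g (ev z t))).

Lemma occ_bound n z : 0 <= occ n z <= n%:R.
Proof.
have mh := @leb_measurable_head R _ n%:R (mg z).
have [_] := leb_int_head_fin (ler0n R n) mh (fun t _ => g01 (ev z t)).
by rewrite mul1r.
Qed.

Definition stage_payoff (n : nat) (h : R) z : R :=
  h / n%:R * occ n z + (1 - h) * U (ev z n%:R).

Lemma occ_mean_bound n z : 0 <= occ n.+1 z / n.+1%:R <= 1.
Proof.
have /andP[y0 y1] := occ_bound n.+1 z.
by rewrite divr_ge0//= ler_pdivrMr ?ltr0n// mul1r.
Qed.

Lemma stage_payoff_bound n h z : 0 <= h <= 1 -> 0 <= stage_payoff n.+1 h z <= 1.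
Proof.
move=> /andP[h0 h1]; have /andP[y0 y1] := occ_mean_bound n z.
have /andP[u0 u1] := U01 (ev z n.+1%:R).
rewrite /stage_payoff mulrAC -mulrA.
set y := (occ _ _ / _) in y0 y1 *; set u := U _ in u0 u1 *.
by apply/andP; split; nra.
Qed.

(** Integrating [ss_tail] identifies [m s] as the mass of [mu] after time [s], because rescaling
    preserves mass. *)
Lemma ss_head mu a C s0 k1 m k s : self_similar mu a C s0 k1 m k ->
  0 < s <= s0 -> leb_int `[0, s[ mu = (1 - m s)%:E.
Proof.
move=> ss s0s; have /andP[s0' ss0] := s0s.
have dmu := ss_density ss; have wmu := density_weight dmu.
have /andP[k0 _] := ss_k ss s0s; have m0 := ss_m ss s0s.
have [wk mk] := weight_scale k0 wmu.
have [_ mm] := weightZ (ltW m0) wk.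
rewrite (mass_split (ltW s0') wmu) (mass_density dmu).
rewrite (@eq_mass _ (fun t => mu (t + s))
                    (fun t => m s * scale_density mu (k s) t)).
  by rewrite mm mk (mass_density dmu) mulr1.
by move=> t t0; exact: (ss_tail ss).
Qed.

(** [head_approx] with [u = 1] compares the mass [1 - m s] of the head with [a * s]. This lets
    [1 - h] replace [m s] in the one-step relation. *)
Lemma ss_mass mu a C s0 k1 m k s : self_similar mu a C s0 k1 m k ->
  0 < s <= s0 -> m s <= 1 /\ `|1 - m s - a * s| <= C * s * s.
Proof.
move=> ss s0s; have /andP[s0' ss0] := s0s.
have dmu := ss_density ss; have E := ss_head ss s0s.
have [mmu pmu _] := dmu.
split.
  rewrite -subr_ge0 -lee_fin -E; apply: leb_int_ge0 => t /=.
  by rewrite in_itv/= => /andP[t0 _]; exact: pmu.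
have E1 : fine (leb_int `[0, s[ (fun=> 1)) = s.
  rewrite leb_int_cst ?leb_co ?subr0 ?mul1e//; first exact: ltW.
  exact: leb_itv.
have := @head_approx R s mu (fun=> 1) a (C * s) (ltW s0') (ltW (ss_a ss)).
rewrite E1 (@eq_leb_int _ _ _ mu); last by move=> t _; rewrite mulr1.
rewrite E /=; apply.
- exact: leb_measurable_head.
- exact: measurable_cst.
- by move=> t /andP[t0 _]; exact: pmu.
- by move=> t _; rewrite ler01 lexx.
- move=> t /andP[t0 ts]; have ts0 : 0 <= t <= s0.
    by rewrite t0/=; exact: le_trans (ltW ts) ss0.
  apply: le_trans (ss_near0 ss ts0) _.
  by apply: ler_wpM2l; [exact: (ss_C ss)|exact: ltW].
Qed.

Lemma one_step_pos mu a C s0 k1 m k : self_similar mu a C s0 k1 m k ->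
  converges_to_U mu ->
  forall eps, 0 < eps -> exists N0 : nat, forall n, (N0 <= n)%N ->
  forall h w, 0 < h <= Num.min (a * s0) 1 ->
  `|U w - stage P w (stage_payoff n.+1 h)| <= 2 * C / a ^+ 2 * h ^+ 2 + eps.
Proof.
move=> ss cv eps eps0.
have e20 : 0 < eps / 2 by rewrite divr_gt0.
have [l0 l00 Hl0] := cv _ e20.
have a0 := ss_a ss; have C0 := ss_C ss; have s00 := ss_s0 ss.
have k10 : 0 < k1.
  have : 0 < s0 <= s0 by rewrite s00 lexx.
  by move=> /(ss_k ss) /andP[]; exact: lt_le_trans.
(* Once [n.+1] exceeds [X], both scales that occur, [l = s / n.+1] for the whole density and
   [k s * l <= k1 * l] for its tail, are below [l0]; the factor [1 + k1] serves both. *)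
set X := s0 * (1 + k1) / l0.
have X0 : 0 <= X by rewrite divr_ge0 ?ltW// mulr_gt0// addr_gt0.
exists (Num.bound X) => n Nn h w /andP[h0]; rewrite le_min => /andP[has h1].
have nX : X < n.+1%:R.
  apply: lt_le_trans (archi_boundP X0) _; rewrite ler_nat.
  exact: leq_trans Nn _.
have n0 : 0 < n.+1%:R :> R by rewrite ltr0n.
set s := h / a.
have s0' : 0 < s by rewrite divr_gt0.
have ss0 : s <= s0 by rewrite ler_pdivrMr// mulrC.
have s0s : 0 < s <= s0 by rewrite s0'.
have /andP[k0 kk1] := ss_k ss s0s; have m0 := ss_m ss s0s.
(* At this scale the time [n.+1] corresponds to the time [s] of [mu]. *)
set l := s / n.+1%:R.
have l_gt0 : 0 < l by rewrite divr_gt0.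
have ll0 : l * (1 + k1) < l0.
  have {}nX : s0 * (1 + k1) < n.+1%:R * l0 by rewrite -ltr_pdivrMr.
  rewrite /l mulrAC ltr_pdivrMr// [ltRHS]mulrC; apply: le_lt_trans nX.
  by rewrite ler_pM2r// addr_gt0.
have lt1 : 0 < l < l0 by rewrite l_gt0/=; nra.
have lt2 : 0 < k s * l < l0 by rewrite mulr_gt0//=; nra.
have dmu := ss_density ss; have wmu := density_weight dmu.
have [wl ml] := weight_scale l_gt0 wmu.
have [wkl mkl] := weight_scale (mulr_gt0 k0 l_gt0) wmu.
have tailE t : 0 <= t -> scale_density mu l (t + n.+1%:R) =
    m s * scale_density mu (k s * l) t.
  move=> t0; rewrite /scale_density mulrDr.
  have -> : l * n.+1%:R = s by rewrite /l divfK// gt_eqF.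
  have lt0 : 0 <= l * t by rewrite mulr_ge0// ltW.
  rewrite (ss_tail ss s0s lt0) /scale_density (mulrA (k s) l t); set mm := mu _; by ring.
have Vtail w' : V (fun t => scale_density mu l (t + n.+1%:R)) w' =
    m s * V (scale_density mu (k s * l)) w'.
  rewrite -(rvalueZ P g01 mg inhL inhM w' m0 wkl).
  by rewrite /rvalue (eq_value ev g P tailE).
have hn : l * a = h / n.+1%:R by rewrite /l /s; field; rewrite !gt_eqF.
have headE z : `|head_pay ev g n.+1 (scale_density mu l) z -
    h / n.+1%:R * occ n.+1 z| <= C * s * s.
  have [mmu pmu _] := wl.
  have := @head_approx R n.+1%:R (scale_density mu l) (fun t => g (ev z t))
    (l * a) (l * C * s) (ltW n0).
  have -> : l * C * s * n.+1%:R = C * s * s.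
    by rewrite /l; field; rewrite gt_eqF.
  rewrite hn; apply.
  - by rewrite divr_ge0// ltW.
  - exact: leb_measurable_head.
  - by apply: leb_measurable_head; exact: mg.
  - by move=> t /andP[t0 _]; exact: pmu.
  - by move=> t _; exact: g01.
  - move=> t /andP[t0 tn]; rewrite -hn /scale_density -mulrBr normrM.
    rewrite (ger0_norm (ltW l_gt0)) -mulrA ler_pM2l//.
    have lts : 0 <= l * t <= s.
      rewrite mulr_ge0 ?(ltW l_gt0)//= /l mulrAC ler_pdivrMr//.
      by rewrite ler_pM2l// ltW.
    have ltss : 0 <= l * t <= s0.
      by case/andP: lts => -> /= /le_trans; exact.
    apply: le_trans (ss_near0 ss ltss) _; apply: ler_wpM2l => //.
    by case/andP: lts.
have [m1 mbound] := ss_mass ss s0s.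
have as_h : a * s = h by rewrite /s mulrC divfK// gt_eqF.
rewrite as_h in mbound.
(* Three errors: the head payoff against [h] times the mean of [g], the value of the tail against
   [U], and [m s] against [1 - h]. Passing from the value to [U] at [w] costs the other
   [eps / 2]. *)
have main : `|V (scale_density mu l) w - stage P w (stage_payoff n.+1 h)| <=
    C * s * s + (eps / 2 + C * s * s).
  have -> : V (scale_density mu l) w =
      stage P w (fun z => head_pay ev g n.+1 (scale_density mu l) z +
        m s * V (scale_density mu (k s * l)) (ev z n.+1%:R)).
    rewrite (rvalue_dp g01 mg inhL inhM dp n w wl); last first.
      by rewrite ml (mass_density dmu).
    by apply: eq_stage => z; rewrite Vtail.
  apply: (@stage_lipschitz _ _ _ _ _ _ P inhL inhM w _ _ (1 + m s) 1).
  - move=> z; have /andP[p0 p1] := head_pay_bound g01 mg n.+1 z wl.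
    have /andP[v0 v1] := rvalue_bound P g01 mg inhL inhM (ev z n.+1%:R) wkl.
    rewrite ml (mass_density dmu) in p1; rewrite mkl (mass_density dmu) in v1.
    rewrite addr_ge0 ?mulr_ge0 ?(ltW m0)//=; apply: lerD => //.
    by rewrite ler_piMr// ltW.
  - by move=> z; apply: stage_payoff_bound; rewrite (ltW h0).
  move=> z; rewrite /stage_payoff.
  have := headE z; have := Hl0 _ lt2 (ev z n.+1%:R).
  have /andP[u0 u1] := U01 (ev z n.+1%:R).
  set u := U _ in u0 u1 *; set v := V _ _; set A := head_pay _ _ _ _ _.
  set B := _ * occ _ _ => Hv HA.
  have -> : A + m s * v - (B + (1 - h) * u) =
      (A - B) + (m s * (v - u) - (1 - m s - h) * u) by ring.
  apply: le_trans (ler_normD _ _) _; apply: lerD => //.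
  apply: le_trans (ler_normB _ _) _; apply: lerD.
    rewrite normrM (gtr0_norm m0); apply: le_trans Hv.
    by rewrite ler_piMl.
  rewrite normrM (ger0_norm u0); apply: le_trans mbound.
  by rewrite ler_piMr.
have -> : 2 * C / a ^+ 2 * h ^+ 2 + eps =
    eps / 2 + (C * s * s + (eps / 2 + C * s * s)).
  by rewrite /s; field; rewrite gt_eqF.
have -> : U w - stage P w (stage_payoff n.+1 h) =
   (U w - V (scale_density mu l) w) +
   (V (scale_density mu l) w - stage P w (stage_payoff n.+1 h)) by ring.
apply: le_trans (ler_normD _ _) _; apply: lerD => //.
by rewrite distrC; exact: Hl0.
Qed.

(** A cell of a grid may have mass 0, so [h = 0] is needed as well. It is reached from a small [h'],
    since [stage_payoff] at [h'] and at 0 differ by at most [h']. *)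
Lemma one_step mu a C s0 k1 m k : self_similar mu a C s0 k1 m k ->
  converges_to_U mu ->
  exists2 h0, 0 < h0 <= 1 & exists2 C', 0 <= C' & forall eps, 0 < eps ->
  exists N0 : nat, forall n, (N0 <= n)%N -> forall h w, 0 <= h <= h0 ->
  `|U w - stage P w (stage_payoff n.+1 h)| <= C' * h ^+ 2 + eps.
Proof.
move=> ss cv; have a0 := ss_a ss; have s00 := ss_s0 ss; have C0 := ss_C ss.
set h0 := Num.min (a * s0) 1; set C' := 2 * C / a ^+ 2.
have h00 : 0 < h0 by rewrite lt_min mulr_gt0//=.
have h01 : h0 <= 1 by rewrite ge_min lexx orbT.
have C'0 : 0 <= C' by rewrite !mulr_ge0// invr_ge0 exprn_ge0// ltW.
exists h0; first by rewrite h00.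
exists C' => // eps eps0.
(* At [h = 0] the error is at most [C' * h' ^+ 2 + e + h'], where both [h'] and [h' ^+ 2] are at
   most [e]; the total is [(C' + 2) * e]. *)
set e := eps / (C' + 2).
have e0 : 0 < e by rewrite divr_gt0//; lra.
have eE : (C' + 2) * e = eps by rewrite /e mulrC divfK// gt_eqF//; lra.
have [N0 HN] := one_step_pos ss cv e0.
exists N0 => n Nn h w /andP[hge0 hh0].
have ee : e <= eps.
  by rewrite -eE mulrDl; have := mulr_ge0 C'0 (ltW e0); lra.
move: hge0; rewrite le_eqVlt => /predU1P[hz|hpos]; last first.
  by apply: le_trans (HN _ Nn h w _) _; [rewrite hpos|rewrite lerD2l].
rewrite -hz expr0n/= mulr0 add0r.
set h' := Num.min e h0.
have h'0 : 0 < h' by rewrite lt_min e0.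
have h'h0 : h' <= h0 by rewrite ge_min lexx orbT.
have h'e : h' <= e by rewrite ge_min lexx.
have h'01 : 0 <= h' <= 1 by rewrite ltW//= (le_trans h'h0).
have B0 : 0 <= (0 : R) <= 1 by rewrite lexx ler01.
have H1 := HN _ Nn h' w; rewrite h'0 h'h0 in H1; have {}H1 := H1 isT.
have H2 : `|stage P w (stage_payoff n.+1 h') -
            stage P w (stage_payoff n.+1 0)| <= h'.
  apply: (@stage_lipschitz _ _ _ _ _ _ P inhL inhM w _ _ 1 1).
  - by move=> z; exact: stage_payoff_bound.
  - by move=> z; exact: stage_payoff_bound.
  move=> z; rewrite /stage_payoff.
  have /andP[y0 y1] := occ_mean_bound n z.
  have /andP[u0 u1] := U01 (ev z n.+1%:R).
  set u := U _ in u0 u1 *.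
  have -> : h' / n.+1%:R * occ n.+1 z + (1 - h') * u -
      (0 / n.+1%:R * occ n.+1 z + (1 - 0) * u) =
      h' * (occ n.+1 z / n.+1%:R - u) by field; rewrite nat1r pnatr_eq0.
  rewrite normrM gtr0_norm// ler_piMr ?(ltW h'0)// ler_norml.
  by set y := (occ _ _ / _) in y0 y1 *; apply/andP; split; lra.
have -> : U w - stage P w (stage_payoff n.+1 0) =
    (U w - stage P w (stage_payoff n.+1 h')) +
    (stage P w (stage_payoff n.+1 h') - stage P w (stage_payoff n.+1 0)) by ring.
apply: le_trans (ler_normD _ _) _.
apply: le_trans (lerD H1 H2) _.
have hh : h' ^+ 2 <= e.
  case/andP: h'01 => h'ge0 h'1; apply: le_trans h'e.
  by rewrite expr2 ler_piMr.
have := ler_wpM2l C'0 hh; rewrite -/C' => {}hh.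
by rewrite -eE mulrDl mulr_natl mulr2n addrA; exact: lerD (lerD hh (lexx _)) h'e.
Qed.

(** Each term of the bound has one origin: [theta] pays for all cells after the remaining mass has
    dropped to [theta], the middle term collects the quadratic errors of the cells before, and each
    cell adds one error [S * eps <= B * eps]. *)
Lemma rvalue_step n h0 C eps theta eta B :
  0 <= h0 <= 1 -> 0 <= C -> 0 <= eps -> 0 < theta -> eta <= h0 * theta ->
  (forall h w, 0 <= h <= h0 ->
    `|U w - stage P w (stage_payoff n.+1 h)| <= C * h ^+ 2 + eps) ->
  forall (p : seq R) w, all (fun x => 0 <= x <= eta) p -> \sum_(x <- p) x <= B ->
  `|V (step n.+1%:R p) w - (\sum_(x <- p) x) * U w| <=
    theta + C * (eta / theta) * (\sum_(x <- p) x) + (size p)%:R * B * eps.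
Proof.
move=> /andP[h00 h01] C0 eps0 theta0 etah H.
have n0 : 0 < n.+1%:R :> R by rewrite ltr0n.
have pos (q : seq R) : all (fun x => 0 <= x <= eta) q -> all (>= 0) q.
  by move=> /allP h; apply/allP => x /h /andP[].
have sum0 (q : seq R) : all (>= 0) q -> 0 <= \sum_(x <- q) x.
  by move=> /allP h; rewrite big_seq; apply: sumr_ge0 => x /h.
elim=> [|x q IH] w pq pB.
  have [ws ms] := @weight_step R n.+1%:R [::] n0 isT.
  have := rvalue_bound P g01 mg inhL inhM w ws; rewrite ms big_nil.
  by move=> /le_anti <-; rewrite !mul0r mulr0 subrr normr0 !addr0 ltW.
have ppos := pos _ pq.
case/andP: (pq) => /andP[x0 xeta] qq; have qpos := pos _ qq.
have Sq0 := sum0 _ qpos.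
have [ws ms] := weight_step n0 ppos.
have [wq mq] := weight_step n0 qpos.
move: pB ms; rewrite !big_cons /=.
set Sq := \sum_(j <- q) j in IH Sq0 mq *; set S := x + Sq => SB ms.
have B0 : 0 <= B by apply: le_trans SB; rewrite addr_ge0.
have eta0 : 0 <= eta by exact: le_trans xeta.
have /andP[u0 u1] := U01 w.
have /andP[v0 v1] := rvalue_bound P g01 mg inhL inhM w ws.
have err0 : 0 <= C * (eta / theta) * S.
  by rewrite mulr_ge0// ?mulr_ge0 ?invr_ge0 ?addr_ge0// ltW.
have err1 : 0 <= (size q).+1%:R * B * eps by rewrite !mulr_ge0.
have [Sth|Sth] := leP S theta.
  have : `|V (step n.+1%:R (x :: q)) w - S * U w| <= S.
    have S0 : 0 <= S by rewrite addr_ge0.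
    rewrite ms in v1; rewrite ler_norml; apply/andP; split; nra.
  by move=> h; lra.
have S0 : 0 < S by exact: lt_trans Sth.
(* The share of the first cell in the remaining mass; [x <= eta <= h0 * theta] and [theta < S] keep
   it below [h0]. *)
set h := x / S.
have hh0 : 0 <= h <= h0.
  rewrite divr_ge0 ?(ltW S0)//= ler_pdivrMr//; nra.
(* After one cell the induction hypothesis replaces the value of the tail by [Sq * U] at the new
   state. This is the second part of [S * stage_payoff], because [S * h = x] and hence
   [S * (1 - h) = Sq]. *)
have Vs : `|V (step n.+1%:R (x :: q)) w -
    stage P w (fun z => S * stage_payoff n.+1 h z)| <=
    theta + C * (eta / theta) * Sq + (size q)%:R * B * eps.
  rewrite (rvalue_dp g01 mg inhL inhM dp n w ws) ?ms//.
  have wsh : weight (fun t => step n.+1%:R (x :: q) (t + n.+1%:R)).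
    exact: weight_shift.
  apply: (@stage_lipschitz _ _ _ _ _ _ P inhL inhM w _ _
      (S + mass (fun t => step n.+1%:R (x :: q) (t + n.+1%:R))) S).
  - move=> z; have /andP[p0 p1] := head_pay_bound g01 mg n.+1 z ws.
    have /andP[r0 r1] := rvalue_bound P g01 mg inhL inhM (ev z n.+1%:R) wsh.
    by rewrite ms in p1; rewrite addr_ge0//= lerD.
  - move=> z; have /andP[p0 p1] : 0 <= stage_payoff n.+1 h z <= 1.
      by apply: stage_payoff_bound; case/andP: hh0 => -> /= /le_trans; exact.
    by rewrite mulr_ge0 ?(ltW S0)//= ler_piMr// ltW.
  move=> z.
  have -> : V (fun t => step n.+1%:R (x :: q) (t + n.+1%:R)) (ev z n.+1%:R) =
      V (step n.+1%:R q) (ev z n.+1%:R).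
    by rewrite /rvalue (eq_value ev g P (@step_shift R n.+1%:R x q)).
  have -> : head_pay ev g n.+1 (step n.+1%:R (x :: q)) z =
      x / n.+1%:R * occ n.+1 z.
    rewrite /head_pay /occ (@eq_leb_int _ _ _ (fun t => x / n.+1%:R * g (ev z t))).
      rewrite leb_intZ.
      - have mh := @leb_measurable_head R _ n.+1%:R (mg z).
        have [E _] := leb_int_head_fin (ltW n0) mh (fun t _ => g01 (ev z t)).
        by rewrite E.
      - exact: leb_itv.
      - exact: leb_measurable_head (mg z).
      - by move=> t _; case/andP: (g01 (ev z t)).
      - by rewrite divr_ge0// ltW.
    by move=> t; rewrite [X in X -> _]/= in_itv/= => /andP[_ ->].
  have -> : x / n.+1%:R * occ n.+1 z + V (step n.+1%:R q) (ev z n.+1%:R) -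
      S * stage_payoff n.+1 h z =
      V (step n.+1%:R q) (ev z n.+1%:R) - Sq * U (ev z n.+1%:R).
    have hS : S * h = x by rewrite /h mulrC divfK// gt_eqF.
    rewrite /stage_payoff; set i := n.+1%:R^-1; set y := occ _ _; set u := U _.
    have -> : S * (h * i * y + (1 - h) * u) = S * h * i * y + (S - S * h) * u.
      by ring.
    by rewrite hS /S; ring.
  by apply: IH => //; apply: le_trans SB; rewrite lerDr.
have Hw := H h w hh0.
have hb z : 0 <= stage_payoff n.+1 h z <= 1.
  by apply: stage_payoff_bound; case/andP: hh0 => -> /= /le_trans; exact.
rewrite (stageZ P inhL inhM w hb S0) in Vs.
have hS : S * h = x by rewrite /h mulrC divfK// gt_eqF.
(* [S * h ^+ 2 = x * h] and [h <= eta / theta]. Being linear in [x], this bound adds up over the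
   cells to the total mass. *)
have Sh2 : S * h ^+ 2 <= eta / theta * x.
  rewrite expr2 mulrA hS mulrC; apply: ler_wpM2r => //.
  rewrite /h ler_pdivrMr// mulrAC ler_pdivlMr//; nra.
have : `|S * (U w - stage P w (stage_payoff n.+1 h))| <=
    C * (eta / theta) * x + B * eps.
  rewrite normrM (gtr0_norm S0); apply: (@le_trans _ _ (S * (C * h ^+ 2 + eps))).
    by rewrite ler_pM2l.
  rewrite mulrDr; apply: lerD; last exact: ler_wpM2r.
  by rewrite mulrCA -mulrA; apply: ler_wpM2l.
move=> HS.
have -> : V (step n.+1%:R (x :: q)) w - S * U w =
    (V (step n.+1%:R (x :: q)) w - S * stage P w (stage_payoff n.+1 h)) -
    S * (U w - stage P w (stage_payoff n.+1 h)) by ring.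
apply: le_trans (ler_normB _ _) _; apply: le_trans (lerD Vs HS) _.
by rewrite -natr1 /S le_eqVlt; apply/orP; left; apply/eqP; ring.
Qed.

End dynamics.

(** * Approximation of piecewise continuous densities by step functions in L^1 *)

Section grid_approximation.
Context {R : realType}.
Local Notation leb := (@completed_lebesgue_measure R).
Local Notation Rp := `[0%R, +oo[%classic.
Local Open Scope ring_scope.
Implicit Types (f h nu : R -> R) (t T e eps : R).

Lemma leb_seq0 (s : seq R) : measurable ([set` s] : set (@LR R)) /\
  leb [set` s] = 0%E.
Proof.
split.
  apply: borel_leb; apply: countable_measurable.
    by move=> x; exact: measurable_set1.
  exact/finite_set_countable/finite_seq.
apply: countable_lebesgue_measure0.
exact/finite_set_countable/finite_seq.
Qed.

Lemma weight_integrable h : weight h -> leb.-integrable (Rp : set (@LR R)) (EFin \o h).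
Proof.
move=> [m p i]; apply/integrableP; split; first exact/measurable_EFinP.
apply: le_lt_trans i; rewrite le_eqVlt; apply/orP; left; apply/eqP.
by apply: eq_integral => t /[!inE] /Rp_ge0 t0 /=; rewrite ger0_norm// p.
Qed.

(** Dominated convergence in epsilon form. The finite set [bad] will hold the breakpoints of the
    density and the ends of the cutoff window. *)
Lemma leb_dominated (f_ : nat -> R -> R) f h (bad : seq R) :
  (forall n, leb_measurable Rp (f_ n)) -> leb_measurable Rp f -> weight h ->
  (forall t, 0 <= t -> t \notin bad ->
     forall e, 0 < e -> exists N, forall n, (N <= n)%N -> `|f_ n t - f t| <= e) ->
  (forall n t, 0 <= t -> `|f_ n t| <= h t) ->
  forall eps, 0 < eps -> exists N, forall n, (N <= n)%N ->
    (leb_int Rp (fun t => `|f_ n t - f t|)%R <= eps%:E)%E.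
Proof.
move=> mf_ mf wh cv dom eps eps0.
have [mb b0] := leb_seq0 bad.
have mEf_ n : measurable_fun (Rp : set (@LR R)) (fun t => (f_ n t)%:E).
  exact/leb_measurable_EFin/mf_.
have mEf : measurable_fun (Rp : set (@LR R)) (fun t => (f t)%:E).
  exact/leb_measurable_EFin.
have cvE : {ae leb, forall t, (Rp : set (@LR R)) t ->
    ((fun n => (f_ n t)%:E) @ \oo --> (f t)%:E)}.
  exists [set` bad]; split => // t /=.
  apply: contra_notP => /negP tbad /Rp_ge0 t0.
  apply/fine_cvgP; split; first by apply: nearW.
  apply/cvgrPdist_le => e e0; have [N HN] := cv t t0 tbad e e0.
  by exists N => // n /= Nn; rewrite distrC; exact: HN.
have domE : {ae leb, forall t, forall n, (Rp : set (@LR R)) t ->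
    (`|(f_ n t)%:E| <= (EFin \o h) t)%E}.
  by apply: aeW => t n /Rp_ge0 t0 /=; rewrite lee_fin dom.
have [_ cv0 _] := dominated_convergence leb_Rp mEf_ mEf cvE
  (weight_integrable wh) domE.
have [N _ HN] : \forall n \near \oo,
    (leb_int Rp (fun t => `|f_ n t - f t|)%R < eps%:E)%E.
  have := cv0 [set x | (x < eps%:E)%E]; apply.
  by apply: open_nbhs_nbhs; split; [exact: open_ereal_lt_ereal|rewrite /= lte_fin].
by exists N => n Nn; apply: ltW; exact: HN.
Qed.

Lemma step_nth T p t i : 0 < T -> i%:R * T <= t < i.+1%:R * T ->
  step T p t = nth 0 p i / T.
Proof.
move=> T0; elim: p t i => [|x q IH] t [|i] /=.
- by rewrite !mul0r.
- by rewrite !mul0r.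
- by rewrite mul1r => /andP[_ ->].
move=> /andP[it ti]; have Tt : T <= t.
  apply: le_trans it; rewrite ler_peMl ?(ltW T0)// ler1n//.
rewrite ltNge Tt/=; apply: IH.
by move: it ti; rewrite -!(natr1 i.+1) -(natr1 i) !mulrDl !mul1r; lra.
Qed.

(** Piecewise continuity only concerns compact subintervals of the open half-line: [nu] may blow up
    at 0 and has unbounded support in general. The window leaves finitely many cells and finitely
    many breakpoints, and the cap bounds the mass of a cell. It is used at [b.+2], where the window
    is nonempty. *)
Definition cutoff nu (b : nat) t : R :=
  Num.min (nu t) b%:R * \1_(`[b%:R^-1, b%:R[) t.

Lemma cutoffE nu b t :
  cutoff nu b t = if b%:R^-1 <= t < b%:R then Num.min (nu t) b%:R else 0.
Proof.
rewrite /cutoff indicE; case: ifPn => bt.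
  by rewrite mem_set ?mulr1//= in_itv.
by rewrite memNset ?mulr0//= in_itv; exact/negP.
Qed.

Lemma cutoff_low nu b t : t < b%:R^-1 -> cutoff nu b t = 0.
Proof. by move=> tb; rewrite cutoffE leNgt tb. Qed.

Lemma cutoff_high nu b t : b%:R <= t -> cutoff nu b t = 0.
Proof. by move=> bt; rewrite cutoffE [t < _]ltNge bt andbF. Qed.

Lemma cutoff_mid nu b t : b%:R^-1 <= t -> t < b%:R ->
  cutoff nu b t = Num.min (nu t) b%:R.
Proof. by move=> bt tb; rewrite cutoffE bt tb. Qed.

Lemma measurable_cutoff nu b : leb_measurable Rp nu ->
  leb_measurable Rp (cutoff nu b).
Proof.
move=> m.
have m1 : leb_measurable Rp (fun t => Num.min (nu t) b%:R).
  exact: (measurable_minr m (measurable_cst _)).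
have m2 : leb_measurable Rp (\1_(`[b%:R^-1, b%:R[) : R -> R).
  apply: borel_leb_measurable; first exact: measurable_itv.
  by apply: measurable_indic; exact: measurable_itv.
exact: (measurable_funM m1 m2).
Qed.

Lemma cutoff_ge0 nu b t : 0 <= nu t -> 0 <= cutoff nu b t.
Proof. by move=> n0; rewrite cutoffE; case: ifP => // _; rewrite le_min n0/=. Qed.

Lemma cutoff_le nu b t : 0 <= nu t -> cutoff nu b t <= nu t.
Proof. by move=> n0; rewrite cutoffE; case: ifP => // _; rewrite ge_min lexx. Qed.

Lemma cutoff_leb nu b t : cutoff nu b t <= b%:R.
Proof. by rewrite cutoffE; case: ifP => // _; rewrite ge_min lexx orbT. Qed.

Lemma cutoff_approx nu eps : is_density nu -> 0 < eps ->
  exists b, (leb_int Rp (fun t => `|nu t - cutoff nu b.+2 t|)%R <= eps%:E)%E.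
Proof.
move=> dnu eps0; have [m p _] := dnu.
have [//|n t t0|N /(_ N (leqnn N)) HN] := @leb_dominated
  (fun b => cutoff nu b.+2) nu nu [:: 0] (fun=> measurable_cutoff _ m) m
  (density_weight dnu) _ _ eps eps0.
- move=> t t0; rewrite inE => tn0 e e0.
  have tpos : 0 < t by rewrite lt_neqAle eq_sym tn0.
  (* An index beyond this sum places [t] inside the window and [nu t] under the cap, so that the
     cutoff equals [nu] at [t]. *)
  set X := nu t + t + t^-1.
  have X0 : 0 <= X by rewrite !addr_ge0 ?p// invr_ge0.
  exists (Num.bound X) => n Nn.
  have nX : X < n.+2%:R.
    apply: lt_le_trans (archi_boundP X0) _; rewrite ler_nat.
    by apply: (leq_trans Nn); rewrite -addn2 leq_addr.
  have ti0 : 0 < t^-1 by rewrite invr_gt0.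
  have nu0 := p t t0.
  rewrite cutoffE ifT; last first.
    rewrite invf_ple ?posrE//; apply/andP; split; rewrite /X in nX; lra.
  rewrite min_l; last by rewrite /X in nX; lra.
  by rewrite subrr normr0 ltW.
- by rewrite ger0_norm ?cutoff_ge0 ?cutoff_le ?p.
- exists N; apply: le_trans HN; rewrite le_eqVlt; apply/orP; left; apply/eqP.
  by apply: eq_leb_int => t _; rewrite distrC.
Qed.

(** Samples at left endpoints, multiplied by the cell length because [step] expects masses. The
    cells reach past [b], where the cutoff vanishes, so ending the list there loses nothing. *)
Definition grid nu (b : nat) (dl : R) : seq R :=
  mkseq (fun i => dl * cutoff nu b (i%:R * dl)) (Num.truncn (b%:R / dl)).+1.

Lemma grid_bound nu b dl : 0 < dl -> (forall t, 0 <= t -> 0 <= nu t) ->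
  all (fun x => 0 <= x <= b%:R * dl) (grid nu b dl).
Proof.
move=> d0 p; apply/allP => _ /mapP[i _ ->].
rewrite mulr_ge0 ?(ltW d0)//=; last first.
  by rewrite cutoff_ge0// p// mulr_ge0// ltW.
by rewrite mulrC ler_pM2r// cutoff_leb.
Qed.

Lemma size_grid nu b dl : 0 < dl -> (size (grid nu b dl))%:R <= b%:R / dl + 1 :> R.
Proof.
move=> d0; rewrite size_mkseq -natr1 lerD2r truncn_le.
by rewrite divr_ge0// ltW.
Qed.

Lemma step_gridE nu b dl t i : 0 < dl -> (i%:R * dl <= t < i.+1%:R * dl) ->
  step dl (grid nu b dl) t = cutoff nu b (i%:R * dl).
Proof.
move=> d0 it; rewrite (step_nth _ d0 it).
have [iN|Ni] := ltnP i (Num.truncn (b%:R / dl)).+1.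
  by rewrite nth_mkseq// mulrC mulrA mulVf ?mul1r// gt_eqF.
rewrite nth_default ?size_mkseq// mul0r cutoff_high//.
rewrite -ler_pdivrMr//; apply: ltW.
have bd0 : 0 <= b%:R / dl by rewrite divr_ge0// ltW.
by rewrite -truncn_lt_nat.
Qed.

Lemma grid_point t dl : 0 < dl -> 0 <= t ->
  exists i : nat, i%:R * dl <= t < i.+1%:R * dl.
Proof.
move=> d0 t0; exists (Num.truncn (t / dl)).
have /truncn_itv : 0 <= t / dl by rewrite divr_ge0// ltW.
by rewrite ler_pdivlMr// ltr_pdivrMr.
Qed.

(** At [t] the step function takes the value of the cutoff at a grid point in []t - dl, t]], so
    continuity of the cutoff at [t] is enough; it can fail at breakpoints of [nu] and at the two
    ends of the window. *)
Lemma step_grid_cvg nu b : piecewise_continuous_pos nu ->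
  exists bad : seq R, forall t, 0 <= t -> t \notin bad ->
  forall e, 0 < e -> exists2 d0, 0 < d0 & forall dl, 0 < dl < d0 ->
    `|step dl (grid nu b.+2 dl) t - cutoff nu b.+2 t| <= e.
Proof.
move=> pc; set B : R := b.+2%:R.
have B1 : 1 < B by rewrite ltr1n.
have B0 : 0 < B by lra.
have Bi0 : 0 < B^-1 by rewrite invr_gt0.
have BiB : B^-1 < B by rewrite (lt_trans _ B1)// invf_lt1.
have [s [cs _]] := pc _ _ Bi0 BiB.
exists [:: B^-1, B & s] => t t0; rewrite !inE !negb_or => /and3P[tBi tB ts] e e0.
have near dl i : 0 < dl -> i%:R * dl <= t < i.+1%:R * dl ->
    t - dl < i%:R * dl <= t.
  by move=> d0 /andP[-> ]; rewrite -natr1 mulrDl mul1r; lra.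
have [tlt|tgt|tE] := ltgtP t B^-1; last by rewrite tE eqxx in tBi.
  exists 1 => // dl /andP[d0 _]; have [i it] := grid_point d0 t0.
  rewrite (step_gridE _ _ d0 it) !cutoff_low ?subrr ?normr0 ?(ltW e0)//.
  by case/andP: it => /le_lt_trans->.
have [tltB|tgtB|tE] := ltgtP t B; last by rewrite tE eqxx in tB.
- have tin : B^-1 <= t <= B by rewrite !ltW.
  have := cs _ tin ts; move/cvgrPdist_le => /(_ e e0) /nbhs_ballP[r r0 Hr].
  have {}r0 : 0 < r by [].
  (* The second bound keeps the sample point inside the window. *)
  exists (Num.min r (t - B^-1)); first by rewrite lt_min r0 subr_gt0.
  move=> dl /andP[d0]; rewrite lt_min => /andP[dr dt].
  have [i it] := grid_point d0 t0; have /andP[n1 n2] := near _ _ d0 it.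
  have in1 : B^-1 <= i%:R * dl.
    by apply/ltW/(lt_trans _ n1); rewrite ltrBrDr addrC -ltrBrDr.
  have in2 : i%:R * dl < B by exact: le_lt_trans n2 tltB.
  rewrite (step_gridE _ _ d0 it) (cutoff_mid nu in1 in2).
  rewrite (cutoff_mid nu (ltW tgt) tltB).
  have H : `|nu t - nu (i%:R * dl)| <= e.
    apply: Hr; rewrite /ball/= ger0_norm ?subr_ge0//.
    by apply: lt_trans dr; rewrite ltrBlDl -ltrBlDr.
  rewrite -/B; move: H; rewrite !ler_norml => /andP[h1 h2].
  (* Capping both values at [B] does not increase their distance. *)
  by rewrite /Num.min; do 2 case: ifPn; rewrite -?leNgt => *; apply/andP; split; lra.
- exists (t - B); first by rewrite subr_gt0.
  move=> dl /andP[d0 dt].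
  have [i it] := grid_point d0 t0; have /andP[n1 n2] := near _ _ d0 it.
  have out : B <= i%:R * dl.
    by apply/ltW/(lt_trans _ n1); rewrite ltrBrDr addrC -ltrBrDr.
  rewrite (step_gridE _ _ d0 it) (cutoff_high nu out) (cutoff_high nu (ltW tgtB)).
  by rewrite subrr normr0 ltW.
Qed.

Lemma step_cutoff_approx nu b eps : is_density nu -> piecewise_continuous_pos nu ->
  0 < eps -> exists2 d0, 0 < d0 & forall dl, 0 < dl < d0 ->
  (leb_int Rp (fun t => `|step dl (grid nu b.+2 dl) t - cutoff nu b.+2 t|)%R
     <= eps%:E)%E.
Proof.
move=> dnu pc eps0; have [m p _] := dnu.
have [bad Hbad] := @step_grid_cvg nu b pc.
(* Dominated convergence is about sequences: if the claim failed for arbitrarily small [dl], there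
   would be a sequence [dl_] of failures tending to 0. *)
apply: contrapT => H.
have {}H (n : nat) : exists dl : R, (0 < dl < n.+1%:R^-1) /\
  ~ (leb_int Rp (fun t => `|step dl (grid nu b.+2 dl) t - cutoff nu b.+2 t|)%R
     <= eps%:E)%E.
  apply: contrapT => Hn; apply: H; exists n.+1%:R^-1; first by rewrite invr_gt0.
  by move=> dl dln; apply: contrapT => Hd; apply: Hn; exists dl.
have [dl_ Hdl] := choice H.
set B : R := b.+2%:R.
have B0 : 0 < B by rewrite ltr0n.
have BB0 : 0 < B + 1 by lra.
(* The dominating function is the constant [B] on [[0, B + 1[], written as a single cell. The extra
   length 1 absorbs the last cell of each grid, since [dl_ n < 1]. *)
have dom0 : all (>= 0) [:: B * (B + 1)] by rewrite /= mulr_ge0// ltW.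
have [wdom _] := weight_step BB0 dom0.
have [|||N /(_ N (leqnn N))] := @leb_dominated
  (fun n => step (dl_ n) (grid nu b.+2 (dl_ n))) (cutoff nu b.+2)
  (step (B + 1) [:: B * (B + 1)]) bad
  _ (measurable_cutoff _ m) wdom _ _ eps eps0.
- move=> n; apply: borel_leb_measurable; first exact: measurable_itv.
  exact: measurable_funTS (measurable_step _ _).
- move=> t t0 tb e e0; have [d0 d00 Hd] := Hbad t t0 tb e e0.
  exists (Num.bound d0^-1) => n Nn; apply: Hd.
  have [/andP[d1 d2] _] := Hdl n; rewrite d1/=; apply: lt_trans d2 _.
  rewrite invf_plt ?posrE//; apply: lt_le_trans (archi_boundP _) _.
    by rewrite invr_ge0 ltW.
  by rewrite ler_nat ltnW.
- move=> n t t0; have [/andP[d1 d2] _] := Hdl n.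
  have [i it] := grid_point d1 t0.
  have nonneg : 0 <= i%:R * dl_ n by rewrite mulr_ge0// ltW.
  rewrite (step_gridE _ _ d1 it) ger0_norm; last by rewrite cutoff_ge0// p.
  rewrite /= mulfK ?gt_eqF//; case: ifPn => tB; first exact: cutoff_leb.
  rewrite cutoff_high// -/B; rewrite -leNgt in tB; case/andP: it => _.
  rewrite -natr1 mulrDl mul1r => it.
  have n1 : n.+1%:R^-1 <= 1 :> R by rewrite invf_le1// ler1n.
  move: B tB it (lt_le_trans d2 n1) {wdom dom0 B0 BB0}; clear => B.
  by set x := dl_ n; lra.
- by have [_] := Hdl N.
Qed.

Lemma grid_approx nu eps : is_density nu -> piecewise_continuous_pos nu ->
  0 < eps -> exists b : nat, exists2 d0, 0 < d0 & forall dl, 0 < dl < d0 ->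
  (leb_int Rp (fun t => `|nu t - step dl (grid nu b.+2 dl) t|)%R <= eps%:E)%E.
Proof.
move=> dnu pc eps0; have e2 : 0 < eps / 2 by rewrite divr_gt0.
have [m p _] := dnu.
have [b Hb] := cutoff_approx dnu e2.
have [d0 d00 Hd] := step_cutoff_approx b dnu pc e2.
exists b, d0 => // dl dld; have Hdl := Hd _ dld.
have ms : leb_measurable Rp (step dl (grid nu b.+2 dl)).
  apply: borel_leb_measurable; first exact: measurable_itv.
  exact: measurable_funTS (measurable_step _ _).
have mc := measurable_cutoff b.+2 m.
have -> : eps%:E = ((eps / 2)%:E + (eps / 2)%:E)%E.
  by rewrite -EFinD -splitr.
apply: le_trans (leeD Hb Hdl).
apply: (leb_int_leD leb_Rp (leb_measurable_dist m ms) (leb_measurable_dist m mc)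
         (leb_measurable_dist ms mc)) => // t _.
by rewrite [X in _ <= _ + X]distrC; exact: ler_distD.
Qed.

End grid_approximation.

(** * Rescaling of step functions and bookkeeping of errors *)

Section scaled_grid.
Context {R : realType}.
Local Notation Rp := `[0%R, +oo[%classic.
Local Open Scope ring_scope.

Lemma step_scale (c T : R) p t : 0 < c -> T != 0 ->
  step T p t = c * step (c * T) p (c * t).
Proof.
move=> c0 T0; elim: p t => [|x q IH] t /=; first by rewrite mulr0.
rewrite ltr_pM2l//; case: ifP => _; last by rewrite IH mulrBr.
by field; rewrite T0 gt_eqF.
Qed.

(** The five errors are the L^1 replacement, the three terms of [rvalue_step], and the deviation
    from 1 of the mass [S] of the grid. *)
Lemma triangle5 (v1 v2 u S a2 a3 e eps : R) :
  `|v1 - v2| <= e -> `|v2 - S * u| <= e + a2 + a3 -> a2 <= e -> a3 <= e ->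
  `|(S - 1) * u| <= e -> 5 * e <= eps -> `|v1 - u| <= eps.
Proof.
move=> h1 h2 h3 h4 h5 h6.
have -> : v1 - u = (v1 - v2) + ((v2 - S * u) + (S - 1) * u) by ring.
apply: le_trans (ler_normD _ _) _.
by apply: le_trans (lerD h1 (le_trans (ler_normD _ _) (lerD h2 h5))) _; lra.
Qed.

Lemma mass_dist (rho rho' : R -> R) c : weight rho -> weight rho' ->
  (leb_int Rp (fun t => `|rho t - rho' t|)%R <= c%:E)%E ->
  `|mass rho - mass rho'| <= c.
Proof.
have le (r r' : R -> R) : weight r -> weight r' ->
    (leb_int Rp (fun t => `|r t - r' t|)%R <= c%:E)%E -> mass r <= mass r' + c.
  move=> wr wr' rc; have [[m p _] [m' p' _]] := (wr, wr').
  rewrite -lee_fin EFinD -!massE//; apply: le_trans (leeD2l _ rc).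
  apply: (leb_int_leD leb_Rp m m' (leb_measurable_dist m m')) => // t.
  - by move=> /Rp_ge0; exact: p.
  - by move=> /Rp_ge0; exact: p'.
  - by move=> _; rewrite -lerBlDl ler_norm.
move=> wr wr' rc; have h1 := le _ _ wr wr' rc.
have h2 : mass rho' <= mass rho + c.
  apply: le => //; rewrite (@eq_leb_int _ _ _ (fun t => `|rho t - rho' t|)%R)//.
  by move=> t _; rewrite distrC.
by rewrite ler_norml; apply/andP; split; lra.
Qed.

(** The L^1 distance is invariant under rescaling, so an approximation of [nu] with cells of length
    [l * T] is one of the rescaled density with cells of length [T]. *)
Lemma leb_int_dist_scale (nu : R -> R) (l T c : R) p : 0 < l -> 0 < T ->
  leb_measurable Rp nu ->
  (leb_int Rp (fun t => `|nu t - step (l * T) p t|)%R <= c%:E)%E ->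
  (leb_int Rp (fun t => `|scale_density nu l t - step T p t|)%R <= c%:E)%E.
Proof.
move=> l0 T0 m; set f := fun t => `|nu t - step (l * T) p t| => fc.
have mf : leb_measurable Rp f.
  apply: leb_measurable_dist => //.
  apply: borel_leb_measurable; first exact: measurable_itv.
  exact: measurable_funTS (measurable_step _ _).
have f0 t : 0 <= f t by exact: normr_ge0.
rewrite (@eq_leb_int _ _ _ (fun t => l * f (l * t))); last first.
  move=> t _; rewrite (@step_scale l T p t l0) ?gt_eqF// /scale_density /f.
  by rewrite -mulrBr normrM (gtr0_norm l0).
rewrite leb_intZ ?(ltW l0)//.
- rewrite leb_int_scale// muleA -EFinM divff ?gt_eqF// mul1e//.
- exact: leb_Rp.
- exact: leb_measurable_scale.
Qed.

End scaled_grid.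

(** * From one self-similar density to every piecewise continuous density *)

Section all_densities.
Context {R : realType} {Omega : Type} {d : measure_display}.
Context {K : measurableType d} (ev : K -> R -> Omega) (g : Omega -> R).
Context (L M : Omega -> Type)
        (P : forall w : Omega, L w -> M w -> probability K R).
Hypothesis g01 : forall w, (0 <= g w <= 1)%R.
Hypothesis mg : forall z, leb_measurable `[0%R, +oo[ (fun t => g (ev z t)).
Hypothesis inhL : forall w, inhabited (L w).
Hypothesis inhM : forall w, inhabited (M w).
Hypothesis dp : forall rho w (n : nat), is_density rho ->
  dp_identity ev g P rho w n.+1%:R.
Variable U : Omega -> R.
Hypothesis U01 : forall w, (0 <= U w <= 1)%R.
Local Open Scope ring_scope.
Local Notation V := (rvalue ev g P).

Lemma converges_to_U_density mu a C s0 k1 m k nu :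
  self_similar mu a C s0 k1 m k -> converges_to_U ev g P U mu ->
  is_density nu -> piecewise_continuous_pos nu -> converges_to_U ev g P U nu.
Proof.
move=> ss cv dnu pc eps eps0.
have [h0 /andP[h00 h01] [C' C'0 Hstep]] := one_step g01 mg inhL inhM dp U01 ss cv.
(* Five errors of size [e] are added in the end; [e <= 1] keeps the mass of the grid at most 2. *)
pose e : R := Num.min (eps / 5) 1.
have e0 : 0 < e by rewrite lt_min divr_gt0 ?ltr01.
have e1 : e <= 1 by rewrite ge_min lexx orbT.
have e5 : 5 * e <= eps.
  by rewrite mulrC -ler_pdivlMr// ge_min lexx.
have wnu := density_weight dnu; have [mnu pnu _] := dnu.
have [b [d0 d00 Hgrid]] := grid_approx dnu pc e0.
pose B : R := b.+2%:R.
have B0 : 0 < B by rewrite ltr0n.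
have C1 : 0 < C' + 1 by apply: ltr_wpDl.
(* With [theta = e] and [eta = B * d1], the three bounds yield the L^1 approximation,
   [eta <= h0 * theta], and a middle term of [rvalue_step] of at most [e] for mass at most 2. The
   [+ 1] avoids a division by [C' = 0]. *)
pose d1 : R := Num.min (d0 / 2) (Num.min (h0 * e / B) (e * e / (2 * B * (C' + 1)))).
have d10 : 0 < d1.
  by rewrite !lt_min !divr_gt0 ?mulr_gt0 ?ltr0n.
have d1d0 : d1 < d0.
  apply: (@le_lt_trans _ _ (d0 / 2)); first by rewrite ge_min lexx.
  by rewrite ltr_pdivrMr// ltr_pMr// ltr1n.
have d1h : B * d1 <= h0 * e.
  by rewrite mulrC -ler_pdivlMr// !ge_min lexx orbT.
have d1C : C' * (B * d1 / e) * 2 <= e.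
  have : d1 <= e * e / (2 * B * (C' + 1)) by rewrite !ge_min lexx !orbT.
  rewrite ler_pdivlMr ?mulr_gt0// => h.
  rewrite mulrA mulrAC ler_pdivrMr//; apply: le_trans h.
  have -> : C' * (B * d1) * 2 = d1 * (2 * B * C') by ring.
  by rewrite ler_pM2l// ler_pM2l ?mulr_gt0// lerDl.
(* A bound on the number of cells that does not depend on [l]: the cell length chosen below is at
   least [d1 / 2]. The one-step error is then fixed relative to it. *)
pose Nmax : R := 2 * B / d1 + 1.
have Nmax0 : 0 < Nmax by rewrite addr_gt0// divr_gt0// mulr_gt0.
have e'0 : 0 < e / (2 * Nmax) by rewrite divr_gt0// mulr_gt0.
have [N0 HN] := Hstep _ e'0.
exists (d1 / N0.+2%:R); first by rewrite divr_gt0.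
move=> l /andP[l0 ll] w.
have lN : N0.+2%:R < d1 / l by rewrite ltr_pdivlMr// mulrC -ltr_pdivlMr.
have dl0 : 0 <= d1 / l by rewrite divr_ge0// ltW.
have /andP[t1 t2] := truncn_itv dl0.
have tN : (N0.+2 <= Num.truncn (d1 / l))%N by rewrite truncn_ge_nat// ltW.
(* The cell length for [nu] is [l * n.+1], the largest multiple of [l] not above [d1]; after
   rescaling by [l] the cells have integer length [n.+1]. *)
case E : (Num.truncn (d1 / l)) tN t1 t2 => [//|n] tN t1 t2.
have Nn : (N0 <= n)%N by rewrite ltnS in tN; exact: ltnW.
have n0 : 0 < n.+1%:R :> R by rewrite ltr0n.
pose dl : R := l * n.+1%:R.
have dl_gt0 : 0 < dl by rewrite mulr_gt0.
have dld1 : dl <= d1 by rewrite /dl mulrC -ler_pdivlMr.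
have d1dl : d1 <= 2 * dl.
  apply: ltW; rewrite ltr_pdivrMr// in t2; apply: lt_le_trans t2 _.
  rewrite /dl mulrCA mulrC ler_pM2l// -natr1 mulr_natl mulr2n lerD2l.
  by rewrite ler1n.
have dlin : 0 < dl < d0 by rewrite dl_gt0 (le_lt_trans dld1).
pose p := grid nu b.+2 dl.
have pb : all (fun x => 0 <= x <= B * d1) p.
  apply: sub_all (grid_bound b.+2 dl_gt0 pnu) => x /andP[-> /= /le_trans]; apply.
  by rewrite ler_pM2l.
have p0 : all (>= 0) p by apply: sub_all pb => x /andP[].
have L1 := leb_int_dist_scale l0 n0 mnu (Hgrid _ dlin).
rewrite -/dl -/p in L1.
have [wp mp] := weight_step n0 p0.
have [wl ml] := weight_scale l0 wnu.
have md := mass_dist wl wp L1; rewrite ml mp (mass_density dnu) in md.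
set S := \sum_(x <- p) x in mp md.
have S2 : S <= 2 by move: md; rewrite ler_norml => /andP[]; lra.
have S0 : 0 <= S by rewrite -mp; exact: mass_ge0.
have VL := rvalue_lipschitz P g01 mg inhL inhM w wl wp L1.
have h0b : 0 <= h0 <= 1 by rewrite ltW.
have VS := rvalue_step g01 mg inhL inhM dp U01 h0b C'0 (ltW e'0) e0 d1h
  (HN _ Nn) w pb S2; rewrite -/S in VS.
have sz : (size p)%:R <= Nmax.
  apply: le_trans (size_grid _ _ dl_gt0) _; rewrite lerD2r -/B.
  by rewrite ler_pdivrMr// mulrAC ler_pdivlMr//
     [2 * B]mulrC -mulrA ler_pM2l.
have err2 : C' * (B * d1 / e) * S <= e.
  apply: le_trans d1C; apply: ler_wpM2l => //.
  by rewrite mulr_ge0// divr_ge0// ?mulr_ge0// ltW.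
have err3 : (size p)%:R * 2 * (e / (2 * Nmax)) <= e.
  have -> : (size p)%:R * 2 * (e / (2 * Nmax)) = (size p)%:R / Nmax * e.
    by field; rewrite gt_eqF.
  rewrite ler_piMl ?(ltW e0)// ler_pdivrMr// mul1r//.
have /andP[u0 u1] := U01 w.
have err4 : `|(S - 1) * U w| <= e.
  by rewrite normrM (ger0_norm u0) distrC; apply: le_trans md; rewrite ler_piMr.
exact: triangle5 VL VS err2 err3 err4 e5.
Qed.

End all_densities.

(** * Uniform, exponential and power densities as self-similar densities *)

Section concrete_densities.
Context {R : realType}.
Local Notation Rp := `[0%R, +oo[%classic.
Local Open Scope ring_scope.
Implicit Types (t s x : R).

Lemma continuous_piecewise (mu : R -> R) :
  (forall x, 0 < x -> {for x, continuous mu}) -> piecewise_continuous_pos mu.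
Proof.
move=> c a b a0 _; exists [::]; split => // x /andP[ax _] _.
by apply: c; exact: lt_le_trans ax.
Qed.

Lemma near_cst_continuous (f : R -> R) x c :
  (\forall t \near x, f t = c) -> {for x, continuous f}.
Proof.
move=> H; have E : f x = c by exact: nbhs_singleton H.
apply/cvgrPdist_le => e e0; near=> t.
have -> : f t = c by near: t.
by rewrite E subrr normr0 ltW.
Unshelve. all: by end_near. Qed.

Lemma unif1E t : unif_density 1 t = if 0 <= t <= 1 then 1 else 0 :> R.
Proof.
rewrite /unif_density invr1 mul1r indicE; case: ifPn => t01.
  by rewrite mem_set//= in_itv.
by rewrite memNset//= in_itv; exact/negP.
Qed.

Lemma unif1_density : is_density (unif_density 1 : R -> R).
Proof.
have E1 : unif_density 1 = \1_(`[0, 1]) :> (R -> R).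
  by apply/funext => t; rewrite /unif_density invr1 mul1r.
have m01 : measurable (`[0, 1]%classic : set R) by exact: measurable_itv.
rewrite E1; split.
- apply: borel_leb_measurable; first exact: measurable_itv.
  exact: measurable_indic.
- by move=> t _; rewrite indicE.
- rewrite leb_int_borel; [|exact: measurable_itv|exact: measurable_indic|
    by move=> t _; rewrite indicE].
  have sub : `[0, 1]%classic `<=` (Rp : set R).
    by move=> t /=; rewrite !in_itv/= => /andP[->].
  apply: (@etrans _ _ (lebesgue_measure (`[0, 1]%classic `&` Rp))).
    by apply: integral_indic => //; exact: measurable_itv.
  by rewrite (setIidl sub) lebesgue_measure_itv/= lte_fin ltr01 oppr0 adde0.
Qed.

Lemma unif1_piecewise : piecewise_continuous_pos (unif_density 1 : R -> R).
Proof.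
have left1 x : 0 < x <= 1 -> \forall t \near x^'-, unif_density 1 t = 1 :> R.
  move=> /andP[x0 x1]; near=> t; rewrite unif1E ifT//; apply/andP; split.
    by near: t; exact: nbhs_left_ge.
  by apply: le_trans x1; near: t; exact: nbhs_left_le.
move=> a b a0 _; exists [:: 1]; split=> [x /andP[ax _]|x].
  rewrite inE => x1; have x0 := lt_le_trans a0 ax.
  have [xlt|xgt|xE] := ltgtP x 1; last by rewrite xE eqxx in x1.
  - apply: (@near_cst_continuous _ _ 1).
    near=> t; rewrite unif1E ifT//; apply/andP; split.
      by apply: ltW; near: t; exact: lt_nbhsr.
    by apply: ltW; near: t; exact: lt_nbhsl.
  - apply: (@near_cst_continuous _ _ 0).
    near=> t; rewrite unif1E ifF//; apply/negbTE.
    rewrite negb_and -!ltNge; apply/orP; right; near: t; exact: lt_nbhsr.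
rewrite inE => /eqP ->; split.
  apply: (cvgP (1 : R)); apply: cvg_near_cst; apply: left1.
  by rewrite ltr01 lexx.
apply: (cvgP (0 : R)); apply: cvg_near_cst; near=> t.
rewrite unif1E ifF//; apply/negbTE; rewrite negb_and -!ltNge; apply/orP; right.
by near: t; exact: nbhs_right_gt.
Unshelve. all: by end_near. Qed.

(** Conditioned on exceeding [s], the remaining time is uniform on [[0, 1 - s]]. Taking [s0 = 2^-1]
    keeps the scale [(1 - s)^-1] at most 2, and [C = 0] because the density is constant there. *)
Lemma unif1_self_similar :
  self_similar (unif_density 1 : R -> R) 1 0 2^-1 2
    (fun s => 1 - s) (fun s => (1 - s)^-1).
Proof.
split=> //.
- exact: unif1_density.
- by move=> s /andP[s0 s1]; lra.
- move=> s /andP[s0 s1]; have h : 2^-1 <= 1 - s by lra.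
  have h0 : 0 < 1 - s by lra.
  by rewrite invr_gt0 h0/= -[leRHS]invrK lef_pV2 ?posrE.
- move=> s t /andP[s0 s1] t0; have h0 : 0 < 1 - s by lra.
  rewrite /scale_density mulrA divff ?gt_eqF// mul1r !unif1E.
  rewrite addr_ge0 ?(ltW s0)//= mulr_ge0 ?invr_ge0 ?(ltW h0)//=.
  by rewrite ler_pdivrMl// mulr1 lerBrDr.
- move=> t /andP[t0 t1]; rewrite unif1E t0/= ifT ?subrr ?normr0 ?mul0r//.
  by lra.
Qed.

Lemma unif_scale T t : 0 < T ->
  unif_density T t = scale_density (unif_density 1) T^-1 t :> R.
Proof.
move=> T0; rewrite /scale_density unif1E /unif_density indicE; congr (_ * _).
rewrite pmulr_rge0 ?invr_gt0// ler_pdivrMl// mulr1; case: ifPn => tT.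
  by rewrite mem_set//= in_itv.
by rewrite memNset//= in_itv; exact/negP.
Qed.

Lemma exp_scale l : exp_density l = scale_density (exp_density 1) l :> (R -> R).
Proof. by apply/funext => t; rewrite /scale_density /exp_density !mul1r. Qed.

Lemma exp1E t : exp_density 1 t = expR (- t).
Proof. by rewrite /exp_density !mul1r. Qed.

Lemma exp1_continuous x : {for x, continuous (exp_density 1 : R -> R)}.
Proof.
have -> : exp_density 1 = expR \o -%R :> (R -> R).
  by apply/funext => t; rewrite exp1E.
apply: continuous_comp; last exact: continuous_expR.
by apply: (@continuousN _ R^o); exact: cvg_id.
Qed.

Lemma exp1_density : is_density (exp_density 1 : R -> R).
Proof.
have m : measurable_fun setT (exp_density 1 : R -> R).
  by apply: continuous_measurable_fun => x; exact: exp1_continuous.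
have mR : measurable_fun (Rp : set R) (exp_density 1 : R -> R) by exact: measurable_funTS.
have p t : 0 <= exp_density 1 t :> R by rewrite exp1E expR_ge0.
split=> //.
- by apply: borel_leb_measurable => //; exact: measurable_itv.
- rewrite leb_int_borel; [|exact: measurable_itv|exact: mR|by move=> t _; exact: p].
  rewrite -(@integral_exponential_pdf R 1 ltr01) integral_mkcond.
  apply: eq_integral => t _; rewrite /exponential_pdf !patchE.
  by case: ifP => // _; rewrite exp1E mul1r mulN1r.
Qed.

(** Memorylessness: the tail is a multiple of the density itself, so the scale is 1. [C = 1] comes
    from 1 - t <= exp(-t) <= 1. *)
Lemma exp1_self_similar :
  self_similar (exp_density 1 : R -> R) 1 1 1 1 (fun s => expR (- s)) (fun=> 1).
Proof.
split=> //.
- exact: exp1_density.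
- by move=> s _; exact: expR_gt0.
- by move=> s _; rewrite ltr01 lexx.
- by move=> s t _ _; rewrite /scale_density !mul1r !exp1E opprD expRD mulrC.
- move=> t /andP[t0 _]; rewrite exp1E mul1r ler_norml.
  have h1 : expR (- t) <= 1 by rewrite -expR0 ler_expR oppr_le0.
  have h2 := expR_ge1Dx (- t).
  by apply/andP; split; lra.
Qed.

(** Normal form of a power density, with [alpha] and [beta] absorbed by rescaling; the value at 0 is
    [a], the constant of [self_similar]. *)
Definition power_shape (a c t : R) : R := a * (1 + t) `^ (- c).

Lemma power_shape_continuous a c x : 0 < x -> {for x, continuous (power_shape a c)}.
Proof.
move=> x0; apply: continuousM; first exact: cvg_cst.
apply: (@continuous_comp _ _ _ (fun t : R => 1 + t) (fun y : R => y `^ (- c))).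
  by apply: continuousD; [exact: cvg_cst|exact: cvg_id].
apply/differentiable_continuous/derivable1_diffP/derivable_powR.
by rewrite in_itv/= andbT addr_gt0.
Qed.

(** Rests on [1 + (t + s) = (1 + s) * (1 + (1 + s)^-1 * t)]. The factor [1 + s] in the tail mass
    cancels the factor [k s] inside [scale_density]. [C = a * c] comes from exp(x) >= 1 + x and ln(1
    + t) <= t. *)
Lemma power_shape_self_similar a c : 0 < a -> 0 < c ->
  is_density (power_shape a c) ->
  self_similar (power_shape a c) a (a * c) 1 1
    (fun s => (1 + s) * (1 + s) `^ (- c)) (fun s => (1 + s)^-1).
Proof.
move=> a0 c0 dmu; split=> //.
- by rewrite mulr_ge0// ltW.
- move=> s /andP[s0 _]; have h : 0 < 1 + s by lra.
  by rewrite mulr_gt0// powR_gt0.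
- move=> s /andP[s0 _]; have h : 0 < 1 + s by lra.
  by rewrite invr_gt0 h/= invf_le1//; lra.
- move=> s t /andP[s0 _] t0; have h : 0 < 1 + s by lra.
  rewrite /scale_density /power_shape.
  have -> : 1 + (t + s) = (1 + s) * (1 + (1 + s)^-1 * t).
    by field; rewrite gt_eqF.
  rewrite powRM ?(ltW h)//; last by rewrite addr_ge0// mulr_ge0// invr_ge0 ltW.
  set x := _ `^ _; set y := _ `^ _.
  by field; rewrite gt_eqF.
- move=> t /andP[t0 _]; have h : 0 < 1 + t by lra.
  rewrite /power_shape.
  have -> : a * (1 + t) `^ (- c) - a = a * ((1 + t) `^ (- c) - 1) by ring.
  rewrite normrM (gtr0_norm a0) -mulrA ler_pM2l//.
  have E : (1 + t) `^ (- c) = expR (- c * ln (1 + t)) by rewrite /powR gt_eqF.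
  have l0 : 0 <= ln (1 + t) by rewrite ln_ge0// lerDl.
  have l1 : ln (1 + t) <= t by rewrite le_ln1Dx//; lra.
  have h1 : (1 + t) `^ (- c) <= 1.
    by rewrite E -[leRHS]expR0 ler_expR mulNr oppr_le0 mulr_ge0// ltW.
  have h2 := expR_ge1Dx (- c * ln (1 + t)); rewrite -E mulNr in h2.
  have h3 : c * ln (1 + t) <= c * t by rewrite ler_pM2l.
  by rewrite ler_norml; apply/andP; split; lra.
Qed.

(** The antiderivative [- (1 + t)^-1] is -1 at 0 and tends to 0 at infinity. The factor [1 *]
    matches the form [alpha + beta * t]. *)
Lemma inverse_square_density :
  is_density (fun t : R => (1 + 1 * t) `^ (- 2)).
Proof.
set f := fun t : R => _.
have m : measurable_fun (Rp : set R) f.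
  apply: measurable_funTS.
  apply: (measurableT_comp (@measurable_powR R (- 2))).
  by apply: measurable_funD => //; apply: measurable_funM.
split=> //.
- by apply: borel_leb_measurable => //; exact: measurable_itv.
- by move=> t _; exact: powR_ge0.
rewrite leb_int_borel; [|exact: measurable_itv|exact: m|
  by move=> t _; exact: powR_ge0].
have fE t : 0 <= t -> f t = (1 + t) ^- 2.
  by move=> t0; rewrite /f mul1r powR_invn// addr_ge0.
have dF t : 0 <= t -> is_derive t 1 (fun y : R => - (1 + y)^-1) (f t).
  move=> t0; have h : 1 + t != 0 by rewrite gt_eqF// ltr_pwDl.
  have d1 : is_derive t 1 (fun y : R => 1 + y) 1.
    have := is_deriveD (is_derive_cst (1 : R) t 1) (is_derive_id t 1).
    by rewrite add0r.
  apply: (is_derive_eq (is_deriveN (is_deriveV h d1))).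
  by rewrite fE// scaleNr opprK -[LHS]/(_ * _) mulr1.
have cF t : 0 <= t -> {for t, continuous (fun y : R => - (1 + y)^-1)}.
  move=> t0; apply/differentiable_continuous/derivable1_diffP.
  by have [] := dF _ t0.
rewrite (@ge0_continuous_FTC2y R f (fun y => - (1 + y)^-1) 0 0).
- by rewrite addr0 invr1 EFinN oppeK add0e.
- by move=> t _; exact: powR_ge0.
- apply: continuous_in_subspaceT => t; rewrite inE/= in_itv/= andbT => t0.
  apply: (@continuous_comp _ _ _ (fun t : R => 1 + 1 * t) (fun y : R => y `^ (- 2))).
    apply: continuousD; first exact: cvg_cst.
    by apply: continuousM; [exact: cvg_cst|exact: cvg_id].
  apply/differentiable_continuous/derivable1_diffP/derivable_powR.
  by rewrite in_itv/= andbT mul1r ltr_pwDl.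
- rewrite -oppr0; apply: cvgN.
  apply/gtr0_cvgV0.
    by exists 0; split => // x x0; rewrite addr_gt0.
  by apply: cvg_addrl; exact: cvg_id.
- by move=> t t0; have [] := dF _ (ltW t0).
- by apply: cvg_at_right_filter; exact: cF.
- move=> t; rewrite in_itv/= andbT => t0.
  by rewrite derive1E; have [_ ->] := dF _ (ltW t0).
Qed.

Lemma inverse_square_power : is_power_density (fun t : R => (1 + 1 * t) `^ (- 2)).
Proof.
split; first exact: inverse_square_density.
by exists 1, 1, 2; split.
Qed.

(** [alpha + beta * (t + T)] is [alpha + beta * T] times [1 + l * t] with
    [l = beta / (alpha + beta * T)]. Hence all normalised shifts are rescalings of one and the same
    shape. *)
Lemma power_density_shape (rho : R -> R) : is_power_density rho ->
  exists alpha beta gamma a : R,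
  [/\ 0 < alpha, 0 < beta, 0 < gamma /\ 0 < a, is_density (power_shape a gamma) &
    forall T, 0 < T -> forall t, 0 <= t ->
      shift_density rho T t =
      scale_density (power_shape a gamma) (beta / (alpha + beta * T)) t].
Proof.
move=> [drho [al [be [ga [al0 be0 ga0 rhoE]]]]].
(* The coefficient for which the shape is [rho] rescaled by [al / be], and therefore a density. *)
pose a := al / be * al `^ (- ga).
have a0 : 0 < a by rewrite mulr_gt0 ?divr_gt0 ?powR_gt0.
have wrho := density_weight drho.
have shapeE t : 0 <= t -> scale_density rho (al / be) t = power_shape a ga t.
  move=> t0; have ab0 : 0 < al / be by rewrite divr_gt0.
  have abt : 0 <= al / be * t by rewrite mulr_ge0// ltW.
  rewrite /scale_density rhoE//.
  have -> : al + be * (al / be * t) = al * (1 + t) by field; rewrite gt_eqF.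
  by rewrite powRM ?(ltW al0) ?addr_ge0// /power_shape /a mulrA.
have dmu : is_density (power_shape a ga).
  have ab0 : 0 < al / be by rewrite divr_gt0.
  have [ws ms] := weight_scale ab0 wrho.
  apply: weight_density; first exact: eq_weight shapeE ws.
  by rewrite -(eq_mass shapeE) ms mass_density.
exists al, be, ga, a; split=> // T T0.
have abT : 0 < al + be * T by rewrite addr_gt0// mulr_gt0.
pose l := be / (al + be * T).
have l0 : 0 < l by rewrite divr_gt0.
(* This ratio turns out to be the mass of [rho] after [T], the normalising constant of the shift. *)
pose c := (al + be * T) `^ (- ga) / (a * l).
have c0 : 0 < c by rewrite divr_gt0 ?powR_gt0// mulr_gt0.
have tailE t : 0 <= t ->
    rho (t + T) = c * scale_density (power_shape a ga) l t.
  move=> t0; rewrite rhoE; last by rewrite addr_ge0// ltW.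
  have -> : al + be * (t + T) = (al + be * T) * (1 + l * t).
    by rewrite /l; field; rewrite gt_eqF.
  rewrite powRM ?(ltW abT)//; last by rewrite addr_ge0// mulr_ge0// ltW.
  rewrite /scale_density /power_shape /c; set x := (_ `^ _); set y := (_ `^ _).
  by field; rewrite !gt_eqF.
have [wl ml] := weight_scale l0 (density_weight dmu).
have [wc mc] := weightZ (ltW c0) wl.
have E : fine (leb_int `[T, +oo[ rho) = c.
  case: (drho) => mr pr _; rewrite (leb_int_tail (ltW T0) mr pr).
  by rewrite -/(mass _) (eq_mass tailE) mc ml (mass_density dmu) mulr1.
move=> t t0; rewrite /shift_density E tailE// -/l.
by rewrite mulrAC divff ?mul1r// gt_eqF.
Qed.

End concrete_densities.

(** * Limits of [sup_dist] expressed by epsilon estimates on real values *)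

Section uniform_convergence.
Context {R : realType} {Omega : Type} {d : measure_display}.
Context {K : measurableType d} (ev : K -> R -> Omega) (g : Omega -> R).
Context (L M : Omega -> Type)
        (P : forall w : Omega, L w -> M w -> probability K R).
Hypothesis inhO : inhabited Omega.
Hypothesis g01 : forall w, (0 <= g w <= 1)%R.
Hypothesis mg : forall z, leb_measurable `[0%R, +oo[ (fun t => g (ev z t)).
Hypothesis inhL : forall w, inhabited (L w).
Hypothesis inhM : forall w, inhabited (M w).
Variable U : Omega -> R.
Local Open Scope ring_scope.
Local Notation V := (rvalue ev g P).
Local Notation dist := (fun rho => sup_dist ev g P rho U).
Implicit Types (rho mu : R -> R).

Lemma near_right0P (Q : R -> Prop) : (\forall l \near 0^'+, Q l) <->
  exists2 l0, 0 < l0 & forall l, 0 < l < l0 -> Q l.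
Proof.
split=> [[r r0 H]|[l0 l00 H]].
  exists r => // l /andP[l0 lr]; apply: H => //=.
  by rewrite sub0r normrN gtr0_norm.
near=> l; apply: H; apply/andP; split; near: l.
  exact: nbhs_right_gt.
exact: nbhs_right_lt.
Unshelve. all: by end_near. Qed.

Lemma near_pinftyP (Q : R -> Prop) : (\forall T \near +oo, Q T) <->
  exists2 T0, 0 < T0 & forall T, T0 < T -> Q T.
Proof.
split=> [[r [_ H]]|[T0 _ H]].
  exists (Num.max r 1); first by rewrite lt_max ltr01 orbT.
  by move=> T; rewrite gt_max => /andP[rT _]; exact: H.
by exists T0; split => //; exact: num_real.
Qed.

Lemma sup_dist_le rho e : weight rho ->
  (dist rho <= e%:E)%E <-> forall w, `|V rho w - U w| <= e.
Proof.
move=> wr; split=> [H w|H].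
  rewrite -lee_fin; apply: le_trans H; apply: ereal_sup_ubound.
  by exists w => //; rewrite (valueE P g01 mg inhL inhM w wr).
apply: ge_ereal_sup => _ [w _ <-].
by rewrite (valueE P g01 mg inhL inhM w wr) -EFinB abse_EFin lee_fin.
Qed.

(** A supremum over no states would be [-oo]; any state makes it nonnegative. *)
Lemma sup_dist_ge0 rho : (0 <= dist rho)%E.
Proof.
have [w] := inhO; apply: le_trans (ereal_sup_ubound _); last by exists w.
exact: abse_ge0.
Qed.

Lemma cvg_sup_distP (F : set_system R) (FF : Filter F) (fam : R -> R -> R) :
  (\forall x \near F, weight (fam x)) ->
  (dist (fam x) @[x --> F] --> 0%:E) <->
  (forall eps, 0 < eps -> \forall x \near F, forall w, `|V (fam x) w - U w| <= eps).
Proof.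
move=> wfam; split=> [cv eps eps0|H].
  have : \forall x \near F, (dist (fam x) < eps%:E)%E.
    have := cv [set y | (y < eps%:E)%E]; apply; apply: open_nbhs_nbhs.
    by split; [exact: open_ereal_lt_ereal|rewrite /= lte_fin].
  move=> H; near=> x; apply/sup_dist_le; first by near: x.
  by apply: ltW; near: x.
have fin eps : 0 < eps -> \forall x \near F, (0 <= dist (fam x) <= eps%:E)%E.
  move=> eps0; near=> x; rewrite sup_dist_ge0/=.
  by apply/sup_dist_le; [near: x|near: x; exact: H].
apply/fine_cvgP; split.
  near=> x; have /andP[s0 s1] : (0 <= dist (fam x) <= 1%:E)%E.
    by near: x; exact: fin.
  by rewrite ge0_fin_numE// (le_lt_trans s1)// ltry.
apply/cvgrPdist_le => e e0; near=> x.
have /andP[s0 s1] : (0 <= dist (fam x) <= e%:E)%E by near: x; exact: fin.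
have sfin : dist (fam x) \is a fin_num.
  by rewrite ge0_fin_numE// (le_lt_trans s1)// ltry.
by rewrite sub0r normrN ger0_norm ?fine_ge0//= -lee_fin fineK.
Unshelve. all: by end_near. Qed.

Lemma cvg_scaleP mu : is_density mu ->
  (dist (scale_density mu l) @[l --> 0^'+] --> 0%:E) <-> converges_to_U ev g P U mu.
Proof.
move=> dmu; have wmu := density_weight dmu.
have wl : \forall l \near 0^'+, weight (scale_density mu l).
  by near=> l; apply: (weight_scale _ wmu).1; near: l; exact: nbhs_right_gt.
apply: (iff_trans (cvg_sup_distP _ wl)).
by split=> H eps /H /near_right0P.
Unshelve. all: by end_near. Qed.

Lemma cvg_unifP :
  (dist (unif_density T) @[T --> +oo] --> 0%:E) <->
  converges_to_U ev g P U (unif_density 1).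
Proof.
have wmu := density_weight (@unif1_density R).
have rv T w : 0 < T ->
    V (unif_density T) w = V (scale_density (unif_density 1) T^-1) w.
  move=> T0; rewrite /rvalue (@eq_value _ _ _ _ ev g _ _ P (unif_density T)
    (scale_density (unif_density 1) T^-1))// => t _.
  exact: unif_scale.
have wT : \forall T \near +oo, weight (unif_density (T : R)).
  apply: (near_pinftyP _).2; exists 1 => // T T1; have T0 : 0 < T by lra.
  have Ti0 : 0 < T^-1 by rewrite invr_gt0.
  apply: eq_weight (weight_scale Ti0 wmu).1 => t _.
  by rewrite unif_scale.
apply: (iff_trans (cvg_sup_distP _ wT)); split=> H eps /H.
  move=> /near_pinftyP[T0 T00 HT]; exists T0^-1; first by rewrite invr_gt0.
  move=> l /andP[l0 lT] w.
  have {}lT : T0 < l^-1 by rewrite -[T0]invrK ltf_pV2 ?posrE ?invr_gt0.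
  have li0 : 0 < l^-1 by rewrite invr_gt0.
  by have := HT _ lT w; rewrite (rv _ _ li0) (invrK l).
move=> [l0 l00 Hl]; apply/near_pinftyP; exists l0^-1; first by rewrite invr_gt0.
move=> T lT w; have T0 : 0 < T by apply: lt_trans lT; rewrite invr_gt0.
by rewrite rv//; apply: Hl; rewrite invr_gt0 T0/= invf_plt ?posrE.
Qed.

(** The scale [be / (al + be * T)] decreases to 0, and every small scale is attained at a large [T];
    this gives both directions. *)
Lemma cvg_powerP rho : is_power_density rho ->
  exists a gamma : R,
  [/\ 0 < a, 0 < gamma, is_density (power_shape a gamma) &
   (dist (shift_density rho T) @[T --> +oo] --> 0%:E) <->
   converges_to_U ev g P U (power_shape a gamma)].
Proof.
move=> /power_density_shape[al [be [ga [a [al0 be0 [ga0 a0] dmu shE]]]]].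
exists a, ga; split=> //; have wmu := density_weight dmu.
pose lam T : R := be / (al + be * T).
have lam0 T : 0 < T -> 0 < lam T.
  by move=> T0; rewrite divr_gt0// addr_gt0// mulr_gt0.
have rv T w : 0 < T ->
    V (shift_density rho T) w = V (scale_density (power_shape a ga) (lam T)) w.
  by move=> T0; rewrite /rvalue (eq_value ev g P (shE _ T0)).
have wT : \forall T \near +oo, weight (shift_density rho T).
  apply: (near_pinftyP _).2; exists 1 => // T T1; have T0 : 0 < T by lra.
  apply: eq_weight (weight_scale (lam0 _ T0) wmu).1 => t t0.
  by rewrite shE.
apply: (iff_trans (cvg_sup_distP _ wT)); split=> H eps /H.
  move=> /near_pinftyP[T0 T00 HT].
  exists (lam T0); first exact: lam0.
  (* This [T] solves [lam T = l], and [l < lam T0] turns into [T0 < T]. *)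
  move=> l /andP[l0 lT] w; pose T := l^-1 - al / be.
  have lamT : lam T = l.
    by rewrite /lam /T; field; rewrite !gt_eqF.
  have TT : T0 < T.
    rewrite /T ltrBrDr -[ltRHS]mul1r ltr_pdivlMr//.
    move: lT; rewrite /lam ltr_pdivlMr ?addr_gt0 ?mulr_gt0// => lT.
    have -> : (T0 + al / be) * l = l * (al + be * T0) / be.
      by field; rewrite gt_eqF.
    by rewrite ltr_pdivrMr// mul1r.
  by rewrite -lamT -rv; [exact: HT|exact: lt_trans TT].
move=> [l0 l00 Hl]; apply/near_pinftyP; exists l0^-1; first by rewrite invr_gt0.
move=> T lT w; have T0 : 0 < T by apply: lt_trans lT; rewrite invr_gt0.
rewrite rv//; apply: Hl; rewrite lam0//= /lam.
apply: (@lt_trans _ _ T^-1); last by rewrite invf_plt ?posrE.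
rewrite ltr_pdivrMr ?addr_gt0 ?mulr_gt0// [ltRHS]mulrC ltr_pdivlMr//.
by rewrite ltrDr.
Qed.

End uniform_convergence.

(** * The equivalences, with (c) as the hub *)

Theorem theorem5 (R : realType) (Omega : Type) (d : measure_display)
  (K : measurableType d) (ev : K -> R -> Omega) (g : Omega -> R)
  (L M : Omega -> Type) (P : forall w : Omega, L w -> M w -> probability K R) :
  inhabited Omega ->
  inhabited K ->
  injective ev ->
  (forall w, (0 <= g w <= 1)%R) ->
  (forall z, leb_measurable `[0%R, +oo[ (fun t => g (ev z t))) ->
  (forall w, inhabited (L w)) ->
  (forall w, inhabited (M w)) ->
  (forall rho, is_density rho ->
     measurable_fun [set: K] (payoff ev g rho) /\
     (forall T : R, (0 < T)%R ->
        measurable_fun [set: K] (fun z => value ev g P rho (ev z T)))) ->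
  ((forall rho w (T : R), is_density rho -> (0 < T)%R ->
       dp_identity ev g P rho w T)
   \/
   ((forall z (n : nat) (s : R), (0 < s < 1)%R -> ev z (n%:R + s)%R = ev z n%:R) /\
    (forall rho w (n : nat), is_density rho ->
       dp_identity ev g P rho w n.+1%:R))) ->
  forall U : Omega -> R, (forall w, (0 <= U w <= 1)%R) ->
  let c_ := forall mu, is_density mu -> piecewise_continuous_pos mu ->
              sup_dist ev g P (scale_density mu lam) U @[lam --> 0%R^'+] --> 0%:E in
  let u_ := sup_dist ev g P (unif_density T) U @[T --> +oo%R] --> 0%:E in
  let e_ := sup_dist ev g P (exp_density lam) U @[lam --> 0%R^'+] --> 0%:E in
  let p_ := exists rho, is_power_density rho /\
              sup_dist ev g P (shift_density rho T) U @[T --> +oo%R] --> 0%:E in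
  let q_ := forall rho, is_power_density rho ->
              sup_dist ev g P (shift_density rho T) U @[T --> +oo%R] --> 0%:E in
  [/\ c_ <-> u_, u_ <-> e_, e_ <-> p_ & p_ <-> q_].
Proof.
move=> inhO inhK inj_ev g01 mg inhL inhM meas DP U U01 c_ u_ e_ p_ q_.
(* Both alternatives give the identity at the positive integer times. *)
have dp rho w (n : nat) : is_density rho -> dp_identity ev g P rho w n.+1%:R.
  by case: DP => [DP|[_ DP]] drho; apply: DP => //; rewrite ltr0n.
have scaleP (mu : R -> R) (dmu : is_density mu) :=
  cvg_scaleP P inhO g01 mg inhL inhM U dmu.
(* Each of (u), (e) and (p) amounts to convergence for one self-similar density, hence implies (c);
   conversely the densities concerned are piecewise continuous, so (c) applies to them. *)
have to_all mu a C s0 k1 m k : self_similar mu a C s0 k1 m k ->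
    converges_to_U ev g P U mu -> c_.
  move=> ss cv nu dnu pc; apply/(scaleP _ dnu).
  exact: (converges_to_U_density g01 mg inhL inhM dp U01 ss cv).
have cu : c_ -> u_.
  move=> c; apply/(cvg_unifP P inhO g01 mg inhL inhM U); apply/scaleP.
    exact: unif1_density.
  by apply: c; [exact: unif1_density|exact: unif1_piecewise].
have uc : u_ -> c_.
  by move=> /(cvg_unifP P inhO g01 mg inhL inhM U); exact: to_all (unif1_self_similar).
have eE : e_ <-> converges_to_U ev g P U (exp_density 1).
  rewrite /e_; under eq_fun do rewrite exp_scale.
  by apply: scaleP; exact: exp1_density.
have ce : c_ -> e_.
  move=> c; apply/eE/scaleP; first exact: exp1_density.
  apply: c; first exact: exp1_density.
  by apply: continuous_piecewise => x _; exact: exp1_continuous.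
have ec : e_ -> c_.
  by move=> /eE; exact: to_all (exp1_self_similar).
have cq : c_ -> q_.
  move=> c rho /(cvg_powerP P inhO g01 mg inhL inhM U)[a [ga [a0 ga0 dmu H]]].
  apply/H/scaleP => //; apply: c => //.
  by apply: continuous_piecewise => x x0; exact: power_shape_continuous.
have pc : p_ -> c_.
  move=> [rho [/(cvg_powerP P inhO g01 mg inhL inhM U)
           [a [ga [a0 ga0 dmu H]]] /H]].
  exact: to_all (power_shape_self_similar a0 ga0 dmu).
(* (q) could hold vacuously, so a power density has to be exhibited. *)
have qp : q_ -> p_.
  move=> q; exists (fun t => (1 + 1 * t) `^ (- 2))%R.
  by split; [|apply: q]; exact: inverse_square_power.
by split; split; auto.
Qed.
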